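(* Suppose that $E\in L^\infty(D\times\Gamma)$, that $0<E_{\min}\le E(\boldsymbol{x},\boldsymbol{y})\le E_{\max}<\infty$ a.e. in $D\times\Gamma$ for some constants $E_{\min},E_{\max}$, that $0<e_0^{\min}\le e_0(\boldsymbol{x})\le e_0^{\max}<\infty$ a.e. in $D$, and that $\frac{1}{e_0^{\min}}\sum_{k=1}^M\|e_k\|_{L^\infty(D)}<1$. Then for any $(\boldsymbol{u},p,\tilde p)\in\boldsymbol{\mathcal V}\times\mathcal W\times\mathcal W$ there exists $(\boldsymbol{v},q,\tilde q)\in\boldsymbol{\mathcal V}\times\mathcal W\times\mathcal W$ with $|||(\boldsymbol{v},q,\tilde q)|||\le C_2\,|||(\boldsymbol{u},p,\tilde p)|||$ satisfying $$\mathcal{B}(\boldsymbol{u},p,\tilde p;\boldsymbol{v},q,\tilde q)\ge E_{\min}\,C_1\,|||(\boldsymbol{u},p,\tilde p)|||^2,$$ where the positive constants $C_1$ and $C_2$ depend on $E_{\max}$, $C_K$ and $C_D$.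
   Context: Fixed domain: $D\subset\mathbb{R}^d$ ($d=2,3$) is a bounded Lipschitz polygon (polyhedron if $d=3$), $\partial D=\partial D_D\cup\partial D_N$ with $\partial D_D\cap\partial D_N=\emptyset$, both parts having nonempty relative interior in $\partial D$. Parameters: $\Gamma=\Gamma_1\times\cdots\times\Gamma_M$ with $\Gamma_k=[-1,1]$, and $\pi=\prod_{k=1}^M\pi_k$ is the product measure with $\pi_k$ the uniform probability measure on $[-1,1]$. The Young's modulus is $E(\boldsymbol{x},\boldsymbol{y})=e_0(\boldsymbol{x})+\sum_{k=1}^M e_k(\boldsymbol{x})y_k$. The Poisson ratio $\nu\in(0,1/2)$ is a fixed constant, $\alpha=\frac{1}{1+\nu}$ and $\beta=\frac{\nu}{1-2\nu}$. Spaces: $\boldsymbol{\mathcal V}=L^2_\pi(\Gamma,\boldsymbol{H}^1_{E_0}(D))$, $\mathcal W=L^2_\pi(\Gamma,L^2(D))$, $\boldsymbol{\mathcal W}=L^2_\pi(\Gamma,\boldsymbol{L}^2(D))$, where $\boldsymbol{H}^1_{E_0}(D)=\{\boldsymbol{v}\in H^1(D;\mathbb{R}^d):\boldsymbol{v}|_{\partial D_D}=\boldsymbol{0}\}$ and $\|v\|_{L^2_\pi(\Gamma,X)}=(\int_\Gamma\|v\|_X^2\,d\pi(\boldsymbol{y}))^{1/2}$. Also $\|\nabla\boldsymbol{v}\|_{\boldsymbol{\mathcal W}}^2=\int_\Gamma\int_D\nabla\boldsymbol{v}:\nabla\boldsymbol{v}\,d\boldsymbol{x}\,d\pi(\boldsymbol{y})$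 and $\boldsymbol{\varepsilon}(\boldsymbol{v})=\frac12(\nabla\boldsymbol{v}+(\nabla\boldsymbol{v})^\top)$ (derivatives with respect to $\boldsymbol{x}$). Forms: $a(\boldsymbol{u},\boldsymbol{v})=\alpha\int_\Gamma\int_D E\,\boldsymbol{\varepsilon}(\boldsymbol{u}):\boldsymbol{\varepsilon}(\boldsymbol{v})\,d\boldsymbol{x}\,d\pi$, $b(\boldsymbol{v},p)=-\int_\Gamma\int_D p\,\mathrm{div}\,\boldsymbol{v}\,d\boldsymbol{x}\,d\pi$, $c(p,q)=(\alpha\beta)^{-1}\int_\Gamma\int_D pq\,d\boldsymbol{x}\,d\pi$, $d(p,q)=(\alpha\beta)^{-1}\int_\Gamma\int_D E\,pq\,d\boldsymbol{x}\,d\pi$, and $$\mathcal{B}(\boldsymbol{u},p,\tilde p;\boldsymbol{v},q,\tilde q)=a(\boldsymbol{u},\boldsymbol{v})+b(\boldsymbol{v},p)+b(\boldsymbol{u},q)-c(\tilde p,q)-c(p,\tilde q)+d(\tilde p,\tilde q).$$ Norm: $|||(\boldsymbol{v},q,\tilde q)|||^2=\alpha\|\nabla\boldsymbol{v}\|_{\boldsymbol{\mathcal W}}^2+(\alpha^{-1}+(\alpha\beta)^{-1})\|q\|_{\mathcal W}^2+(\alpha\beta)^{-1}\|\tilde q\|_{\mathcal W}^2$. Constants: $C_K\in(0,1]$ is the Korn constant, i.e. $\int_D\boldsymbol{\varepsilon}(\boldsymbol{v}):\boldsymbol{\varepsilon}(\boldsymbol{v})\,d\boldsymbol{x}\ge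 C_K\int_D\nabla\boldsymbol{v}:\nabla\boldsymbol{v}\,d\boldsymbol{x}$ for all $\boldsymbol{v}\in\boldsymbol{H}^1_{E_0}(D)$; $C_D>0$ is an inf–sup constant, i.e. $\sup_{\boldsymbol{0}\ne\boldsymbol{v}\in\boldsymbol{\mathcal V}}b(\boldsymbol{v},q)/\|\nabla\boldsymbol{v}\|_{\boldsymbol{\mathcal W}}\ge C_D\|q\|_{\mathcal W}$ for all $q\in\mathcal W$. *)

(* Defs.v *)
From HB Require Import structures.
From mathcomp Require Import all_boot all_order all_algebra.
From mathcomp Require Import all_classical all_reals all_analysis.
Set Implicit Arguments.
Unset Strict Implicit.
Unset Printing Implicit Defensive.
Import Order.TTheory GRing.Theory Num.Theory.
Import numFieldNormedType.Exports.
Local Open Scope classical_set_scope.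
Local Open Scope ring_scope.

(* R^n is 'rV[R]_n, with the product sigma-algebra generated by the
   coordinates (the same as the Borel sigma-algebra, see open_measurable_rV). *)
Definition rV_display : measure_display.
Proof. by constructor. Qed.

Section rV_measurable.
Context {R : realType} {n : nat}.

Definition rV_coord (i : 'I_n) (x : 'rV[R]_n) : measurableTypeR R := x ord0 i.

HB.instance Definition _ := @isMeasurable.Build rV_display
  'rV[R]_n (g_sigma_preimage rV_coord) (@sigma_algebra0 _ _ _)
  (@sigma_algebraC _ _) (@sigma_algebra_bigcup _ _ _).

Lemma measurable_coord (i : 'I_n) :
  measurable_fun [set: 'rV[R]_n] (rV_coord i).
Proof.
move=> _ Y mY; rewrite setTI; apply: sub_sigma_algebra => /=.
rewrite -bigcup_seq/=; exists i => /=; first by rewrite mem_index_enum.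
by exists Y => //; rewrite setTI.
Qed.

Lemma measurable_fun_rV d (T : measurableType d) (f : T -> 'rV[R]_n) :
  (forall i, measurable_fun setT (rV_coord i \o f)) -> measurable_fun setT f.
Proof.
move=> mf _ A mA; rewrite setTI.
have : preimage_set_system [set: T] f (g_sigma_preimage rV_coord) (f @^-1` A).
  by exists A => //; rewrite setTI.
rewrite -g_sigma_preimage_comp.
apply: smallest_sub; first exact: sigma_algebra_measurable.
rewrite -bigcup_seq; apply: bigcup_sub => i _ _ [B mB <-].
exact: mf.
Qed.

End rV_measurable.

Section borel.
Context {R : realType} {n : nat}.

Lemma measurable_ball_rV (x : 'rV[R]_n) (e : R) : measurable (ball x e).
Proof.
have [e0|e0] := ltP 0 e; last first.
  rewrite (_ : ball x e = set0); first exact: measurable0.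
  by apply/seteqP; split => // y [] /(le_lt_trans e0); rewrite ltxx.
have -> : ball x e =
    \bigcap_(i in [set: 'I_n]) (rV_coord i @^-1` ball (x ord0 i) e).
  apply/seteqP; split => [y [_ xy] i _|y xy]; first exact: xy.
  by split => // i j; rewrite ord1; exact: xy.
apply: fin_bigcap_measurable => // i _; rewrite -[X in measurable X]setTI.
by apply: measurable_coord => //; exact: measurable_realfun.measurable_ball.
Qed.

Lemma open_measurable_rV (U : set 'rV[R]_n) : open U -> measurable U.
Proof.
move=> oU.
pose c (q : 'rV[rat]_n) : 'rV[R]_n := map_mx ratr q.
pose I := [set p : 'rV[rat]_n * nat | ball (c p.1) p.2.+1%:R^-1 `<=` U].
have -> : U = \bigcup_(p in I) ball (c p.1) p.2.+1%:R^-1.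
  apply/seteqP; split => [x Ux|x [p Ip]]; last exact: Ip.
  have /nbhs_ballP[e /= e0 xeU] : nbhs x U by exact: open_nbhs_nbhs.
  have /ltr_add_invr[k] : 0 < e / 2 by rewrite divr_gt0.
  rewrite add0r => ke.
  have qi (i : 'I_n) : exists q : rat, `|x ord0 i - ratr q| < k.+1%:R^-1.
    have k0 : 0 < k.+1%:R^-1 :> R by rewrite invr_gt0.
    have : x ord0 i - k.+1%:R^-1 < x ord0 i + k.+1%:R^-1.
      by rewrite ltrD2l gtrN.
    move=> /rat_in_itvoo[q]; rewrite in_itv/= => /andP[q1 q2].
    by exists q; rewrite distrC ltr_distl q1 q2.
  pose q : 'rV[rat]_n := \row_i projT1 (cid (qi i)).
  have qE i : `|x ord0 i - c q ord0 i| < k.+1%:R^-1.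
    by rewrite !mxE; case: cid.
  exists (q, k) => /=; last first.
    by split => // i j; rewrite ord1 /ball/= distrC; exact: qE.
  move=> y [_ qy]; apply: xeU; split => // i j; rewrite ord1 /ball /=.
  have := qy ord0 j; rewrite /ball/= => qyj.
  rewrite (splitr e) (le_lt_trans (ler_distD (c q ord0 j) _ _))// ltrD//.
    by rewrite (lt_trans (qE j)).
  by rewrite (lt_trans qyj).
rewrite bigcup_mkcond; apply: countable_bigcupT_measurable => [|p].
  exact: countableP.
by case: ifPn => _ //; exact: measurable_ball_rV.
Qed.

End borel.

Lemma sigma_finite_prod d1 d2 (T1 : measurableType d1)
    (T2 : measurableType d2) (R : realType)
    (m1 : {sigma_finite_measure set T1 -> \bar R})
    (m2 : {sigma_finite_measure set T2 -> \bar R}) :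
  sigma_finite setT (m1 \x m2)%E.
Proof.
have /sigma_finiteP[F [TF ndF Foo]] := sigma_finiteT m1.
have /sigma_finiteP[G [TG ndG Goo]] := sigma_finiteT m2.
exists (fun n => F n `*` G n).
  rewrite -setXTT TF TG predeqE => -[x y]; split.
    move=> [/= [n _ Fnx] [k _ Gky]]; exists (maxn n k) => //; split.
    - by move: x Fnx; exact/subsetPset/ndF/leq_maxl.
    - by move: y Gky; exact/subsetPset/ndG/leq_maxr.
  by move=> [n _ []/= ? ?]; split; exists n.
move=> k; have [? ?] := Foo k; have [? ?] := Goo k.
split; first exact: measurableX.
by rewrite product_measure1E// lte_mul_pinfty// ge0_fin_numE.
Qed.

Section rV_measure_step.
Context {R : realType} {n : nat}.
Variables (m : {sigma_finite_measure set (measurableTypeR R) -> \bar R})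
  (mu : {sigma_finite_measure set 'rV[R]_n -> \bar R}).

Definition rV_cons (z : measurableTypeR R * 'rV[R]_n) : 'rV[R]_n.+1 :=
  row_mx (z.1%:M : 'rV[R]_1) z.2.

Lemma rV_consE z (i : 'I_n.+1) : rV_cons z ord0 i =
  if unlift ord0 i is Some j then z.2 ord0 j else z.1.
Proof.
rewrite /rV_cons; case: unliftP => [j|] ->.
  rewrite -(row_mxEr (z.1%:M : 'rV[R]_1) z.2 ord0 j).
  by congr (row_mx _ _ _ _); exact/val_inj.
transitivity ((z.1%:M : 'rV[R]_1) ord0 ord0); last by rewrite mxE eqxx.
rewrite -(row_mxEl (z.1%:M : 'rV[R]_1) z.2 ord0 ord0).
by congr (row_mx _ _ _ _); exact/val_inj.
Qed.

Lemma measurable_rV_cons : measurable_fun setT rV_cons.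
Proof.
apply: measurable_fun_rV => i.
rewrite (_ : _ \o _ = fun z => if unlift ord0 i is Some j then
  rV_coord j z.2 else z.1); last by apply/funext => z; rewrite /= /rV_coord rV_consE.
case: unliftP => [j _|_]; last exact: measurable_fst.
by apply: (measurableT_comp (measurable_coord j)); exact: measurable_snd.
Qed.

Definition rV_measure_step : set 'rV[R]_n.+1 -> \bar R :=
  pushforward (m \x mu)%E rV_cons.

Let step0 : rV_measure_step set0 = 0%E.
Proof. by rewrite /rV_measure_step /pushforward preimage_set0 measure0. Qed.

Let step_ge0 A : (0 <= rV_measure_step A)%E.
Proof. by rewrite /rV_measure_step /pushforward; exact: measure_ge0. Qed.

Let step_sigma_additive : semi_sigma_additive rV_measure_step.
Proof.
move=> F mF tF mUF; rewrite /rV_measure_step /pushforward preimage_bigcup.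
apply: measure_semi_sigma_additive.
- by move=> k; rewrite -[X in measurable X]setTI; exact: measurable_rV_cons.
- apply/trivIsetP => /= i j _ _ ij; rewrite -preimage_setI.
  by move/trivIsetP : tF => /(_ _ _ _ _ ij) ->//; rewrite preimage_set0.
- rewrite -preimage_bigcup -[X in measurable X]setTI.
  exact: measurable_rV_cons.
Qed.

HB.instance Definition _ := isMeasure.Build _ _ _
  rV_measure_step step0 step_ge0 step_sigma_additive.

Let step_sigma_finite : sigma_finite setT rV_measure_step.
Proof.
have [F UF mF] := sigma_finite_prod m mu.
pose g (x : 'rV[R]_n.+1) : measurableTypeR R * 'rV[R]_n :=
  (rV_coord ord0 x, \row_j x ord0 (lift ord0 j)).
have gK z : g (rV_cons z) = z.
  case: z => a x; congr pair; first by rewrite /rV_coord rV_consE unlift_none.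
  by apply/rowP => j; rewrite mxE rV_consE liftK.
have mg : measurable_fun setT g.
  apply/measurable_fun_pairP; split; first exact: measurable_coord.
  apply: measurable_fun_rV => i.
  rewrite (_ : _ \o _ = rV_coord (lift ord0 i)); first exact: measurable_coord.
  by apply/funext => x; rewrite /rV_coord/= mxE.
exists (fun k => g @^-1` F k); first by rewrite -preimage_bigcup -UF preimage_setT.
move=> k; split.
  by rewrite -[X in measurable X]setTI; apply: mg => //; exact: (mF k).1.
rewrite /rV_measure_step /pushforward.
rewrite (_ : _ @^-1` _ = F k); first exact: (mF k).2.
by apply/seteqP; split => z /=; rewrite gK.
Qed.

HB.instance Definition _ := Measure_isSigmaFinite.Build _ _ _
  rV_measure_step step_sigma_finite.

End rV_measure_step.

(* The n-fold product m \x ... \x m on R^n. *)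
Fixpoint rV_measure (R : realType)
    (m : {sigma_finite_measure set (measurableTypeR R) -> \bar R}) (n : nat) :
    {sigma_finite_measure set 'rV[R]_n -> \bar R} :=
  match n with
  | 0%N => \d_(0 : 'rV[R]_0)
  | n'.+1 => rV_measure_step m (rV_measure m n')
  end.

Definition leb (R : realType) (n : nat) :
    {sigma_finite_measure set 'rV[R]_n -> \bar R} :=
  rV_measure (@lebesgue_measure R) n.

Lemma ltN11 (R : realType) : (- 1 < 1 :> R).
Proof. by rewrite gtrN. Qed.

(* pi = pi_1 \x ... \x pi_M with pi_k uniform on [-1, 1]; it is a measure on
   R^M carried by Gamma = [-1, 1]^M, so that integrals over Gamma are written
   as integrals against it. *)
Definition pi_Gamma (R : realType) (M : nat) :
    {sigma_finite_measure set 'rV[R]_M -> \bar R} :=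
  rV_measure (uniform_prob (ltN11 R)) M.

Section geometry.
Context {R : realType} {d : nat}.
Implicit Types D A : set 'rV[R]_d.

Definition frontier D : set 'rV[R]_d := closure D `\` interior D.

(* Near each boundary point D is the strict epigraph of a Lipschitz function
   in the orthonormal coordinate system given by the rows of P and by nu. *)
Definition lipschitz_boundary D : Prop :=
  forall x, frontier D x ->
  exists (P : 'M[R]_(d.-1, d)) (nu : 'rV[R]_d) (g : 'rV[R]_d.-1 -> R) (k : R),
  [/\ P *m P^T = 1%:M, nu *m nu^T = 1%:M, P *m nu^T = 0, k.-lipschitz g
    & \forall z \near x, D z <-> g (z *m P^T) < (z *m nu^T) ord0 ord0].

Definition flat_boundary D : Prop :=
  exists (m : nat) (nu : 'I_m -> 'rV[R]_d) (c : 'I_m -> R),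
  (forall i, nu i != 0) /\
  (forall x, frontier D x -> exists i, (x *m (nu i)^T) ord0 ord0 = c i).

Definition nonempty_relative_interior D A : Prop :=
  exists2 x, A x & \forall z \near x, frontier D z -> A z.

End geometry.

(* A bounded Lipschitz polygon (d = 2) or polyhedron (d = 3), with the
   splitting of its boundary. *)
Record domain (R : realType) (d : nat) := Domain {
  dom :> set 'rV[R]_d;
  bdD : set 'rV[R]_d;
  bdN : set 'rV[R]_d;
  dom_open : open dom;
  dom_neq0 : dom !=set0;
  dom_connected : connected dom;
  dom_bounded : bounded_set dom;
  dom_lipschitz : lipschitz_boundary dom;
  dom_flat : flat_boundary dom;
  bdDN_cover : bdD `|` bdN = frontier dom;
  bdDN_disjoint : bdD `&` bdN = set0;
  bdD_interior : nonempty_relative_interior dom bdD;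
  bdN_interior : nonempty_relative_interior dom bdN }.

Arguments dom_open {R d}.
Arguments dom_neq0 {R d}.
Arguments dom_connected {R d}.
Arguments dom_bounded {R d}.
Arguments dom_lipschitz {R d}.
Arguments dom_flat {R d}.
Arguments bdDN_cover {R d}.
Arguments bdDN_disjoint {R d}.
Arguments bdD_interior {R d}.
Arguments bdN_interior {R d}.

Section lebesgue_on.
Context {R : realType} {d : nat} (D : domain R d).

Definition leb_on : set 'rV[R]_d -> \bar R :=
  mrestr (leb R d) (open_measurable_rV (dom_open D)).

HB.instance Definition _ := Measure.on leb_on.

Let leb_on_sigma_finite : sigma_finite setT leb_on.
Proof.
have [F UF mF] := sigma_finiteT (leb R d).
exists F => // k; have [mFk Fkoo] := mF k; split => //.
rewrite /leb_on /mrestr (le_lt_trans _ Fkoo)// le_measure// inE//.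
by apply: measurableI => //; exact: (open_measurable_rV (dom_open D)).
Qed.

HB.instance Definition _ := Measure_isSigmaFinite.Build _ _ _
  leb_on leb_on_sigma_finite.

End lebesgue_on.

Section smooth.
Context {R : realType} {d : nat}.
Implicit Types f : 'rV[R]_d -> R.

Definition partial (j : 'I_d) f (x : 'rV[R]_d) : R :=
  'D_(delta_mx ord0 j) f x.

Fixpoint Ck (k : nat) f : Prop :=
  continuous f /\
  match k with
  | 0%N => True
  | k'.+1 => forall j, (forall x, derivable f x (delta_mx ord0 j)) /\
                       Ck k' (partial j f)
  end.

Definition smooth f : Prop := forall k, Ck k f.

Definition test_function (D : set 'rV[R]_d) f : Prop :=
  smooth f /\
  exists K, [/\ compact K, K `<=` D & forall x, ~ K x -> f x = 0].

Definition jacobian_mx (f : 'rV[R]_d -> 'rV[R]_d) (x : 'rV[R]_d) : 'M[R]_d :=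
  \matrix_(i, j) partial j (fun z => f z ord0 i) x.

End smooth.

Definition frob {R : realType} {m n : nat} (A B : 'M[R]_(m, n)) : R :=
  \sum_i \sum_j A i j * B i j.

Definition eps {R : realType} {n : nat} (G : 'M[R]_n) : 'M[R]_n :=
  2^-1 *: (G + G^T).

(* An element of H^1(D; R^d) is represented by the pair of a function and of
   its weak gradient, (grad v)_ij = d_j v_i, which it determines a.e. *)
Definition H1rep (R : realType) (d : nat) : Type :=
  (('rV[R]_d -> 'rV[R]_d) * ('rV[R]_d -> 'M[R]_d))%type.

Section spaces.
Context {R : realType} {d : nat} (D : domain R d).

Definition L2 : set ('rV[R]_d -> R) := [set p | p \in Lfun (leb_on D) 2%:E].

Definition normL2 (p : 'rV[R]_d -> R) : R :=
  Num.sqrt (\int[leb_on D]_x (p x) ^+ 2).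

Definition normH1 (w : H1rep R d) : R :=
  Num.sqrt (\int[leb_on D]_x (frob (w.1 x) (w.1 x) + frob (w.2 x) (w.2 x))).

Definition weak_gradient (w : H1rep R d) : Prop :=
  forall phi, test_function D phi -> forall i j,
    \int[leb_on D]_x (w.1 x ord0 i * partial j phi x) =
    - \int[leb_on D]_x (w.2 x i j * phi x).

Definition H1 : set (H1rep R d) :=
  [set w : H1rep R d | [/\ forall i, L2 (fun x => w.1 x ord0 i),
               forall i j, L2 (fun x => w.2 x i j)
             & weak_gradient w]].

(* The boundary lies in finitely many hyperplanes, so L^2(boundary) and
   surface null sets are tested through all isometric affine parametrizations
   of hyperplanes and (d-1)-dimensional Lebesgue measure. *)
Definition chart (a : 'rV[R]_d) (Q : 'M[R]_(d.-1, d)) (t : 'rV[R]_d.-1) :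
  'rV[R]_d := a + t *m Q.

(* g is the trace of w: the limit in L^2(boundary) of the restrictions of
   functions smooth up to the boundary that converge to w in H^1(D). *)
Definition is_trace (w : H1rep R d) (g : 'rV[R]_d -> 'rV[R]_d) : Prop :=
  measurable_fun setT g /\
  exists phi : nat -> 'rV[R]_d -> 'rV[R]_d,
  [/\ forall n i, smooth (fun x => phi n x ord0 i),
      normH1 (w - (phi n, jacobian_mx (phi n))) @[n --> \oo] --> (0 : R)
    & forall a Q, Q *m Q^T = 1%:M ->
      (\int[leb R d.-1]_(t in chart a Q @^-1` frontier D)
         (frob (phi n (chart a Q t) - g (chart a Q t))
               (phi n (chart a Q t) - g (chart a Q t)))%:E)%E
      @[n --> \oo] --> (0 : \bar R)%E].

Definition H1_E0 : set (H1rep R d) :=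
  [set w : H1rep R d | H1 w /\
    exists2 g, is_trace w g &
      forall a Q, Q *m Q^T = 1%:M ->
        {ae leb R d.-1, forall t, bdD D (chart a Q t) -> g (chart a Q t) = 0}].

End spaces.

(* L^2_pi(Gamma, Z) for a subspace Z of X with norm N. Elements are functions
   rather than classes; each class has a representative which is an everywhere
   pointwise limit of simple functions. *)
Section bochner.
Context {R : realType} (M : nat) {X : zmodType} (Z : set X) (N : X -> R).
Implicit Types v s : 'rV[R]_M -> X.

Definition simple s : Prop :=
  [/\ finite_set (range s), range s `<=` Z
    & forall z, measurable (s @^-1` [set z])].

Definition strongly_measurable v : Prop :=
  exists s : nat -> 'rV[R]_M -> X,
    (forall n, simple (s n)) /\
    (forall y, N (v y - s n y) @[n --> \oo] --> (0 : R)).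

Definition bochnerL2 : set ('rV[R]_M -> X) :=
  [set v | [/\ forall y, Z (v y), strongly_measurable v
             & (\int[pi_Gamma R M]_y (N (v y) ^+ 2)%:E < +oo)%E]].

Definition bochner_norm v : R :=
  Num.sqrt (\int[pi_Gamma R M]_y (N (v y) ^+ 2)).

End bochner.

Section forms.
Context {R : realType} {d : nat} (D : domain R d) (M : nat).
Implicit Types (u v : 'rV[R]_M -> H1rep R d) (p q : 'rV[R]_M -> 'rV[R]_d -> R)
  (E : 'rV[R]_d -> 'rV[R]_M -> R) (alpha beta : R).

Definition V : set ('rV[R]_M -> H1rep R d) :=
  @bochnerL2 R M _ (H1_E0 D) (normH1 D).

Definition W : set ('rV[R]_M -> 'rV[R]_d -> R) :=
  @bochnerL2 R M _ (L2 D) (normL2 D).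

Definition normV v : R := @bochner_norm R M _ (normH1 D) v.

Definition normW q : R := @bochner_norm R M _ (normL2 D) q.

Definition norm_grad v : R :=
  Num.sqrt (\int[pi_Gamma R M]_y \int[leb_on D]_x
              frob ((v y).2 x) ((v y).2 x)).

Definition form_a alpha E u v : R :=
  alpha * \int[pi_Gamma R M]_y \int[leb_on D]_x
            (E x y * frob (eps ((u y).2 x)) (eps ((v y).2 x))).

Definition form_b v p : R :=
  - \int[pi_Gamma R M]_y \int[leb_on D]_x (p y x * \tr ((v y).2 x)).

Definition form_c alpha beta p q : R :=
  (alpha * beta)^-1 *
    \int[pi_Gamma R M]_y \int[leb_on D]_x (p y x * q y x).

Definition form_d alpha beta E p q : R :=
  (alpha * beta)^-1 *
    \int[pi_Gamma R M]_y \int[leb_on D]_x (E x y * p y x * q y x).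

Definition form_B alpha beta E u p pt v q qt : R :=
  form_a alpha E u v + form_b v p + form_b u q
  - form_c alpha beta pt q - form_c alpha beta p qt
  + form_d alpha beta E pt qt.

Definition triple_norm alpha beta v q qt : R :=
  Num.sqrt (alpha * norm_grad v ^+ 2
            + (alpha^-1 + (alpha * beta)^-1) * normW q ^+ 2
            + (alpha * beta)^-1 * normW qt ^+ 2).

Definition korn_constant (CK : R) : Prop :=
  forall w, H1_E0 D w ->
    CK * (\int[leb_on D]_x frob (w.2 x) (w.2 x))
    <= \int[leb_on D]_x frob (eps (w.2 x)) (eps (w.2 x)).

Definition infsup_constant (CD : R) : Prop :=
  forall q, W q ->
    ((CD * normW q)%R%:E <=
     ereal_sup [set (form_b v q / norm_grad v)%R%:E
               | v in [set v | V v /\ normV v != 0%R]])%E.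

End forms.

Definition young (R : realType) (d M : nat) (e0 : 'rV[R]_d -> R)
    (e : 'I_M -> 'rV[R]_d -> R) (x : 'rV[R]_d) (y : 'rV[R]_M) : R :=
  e0 x + \sum_(k < M) e k x * y ord0 k.

(* Main.v *)
(* Take v = u + s w, q = -p, q~ = p~ - t p, where w is an inf-sup partner of p
   with |grad w| <= |p| and b(w, p) >= (C_D / 2) |p|^2. The terms b(u, p) and
   c(p, p~) cancel; a(u, u) and d(p~, p~) control u and p~ (by Korn's inequality
   and E >= Emin), s b(w, p) and t c(p, p) control p in its two weights, and the
   cross terms s a(u, w) and t d(p~, p) are absorbed by Cauchy-Schwarz and AM-GM
   when s alpha / Emin and t / Emin are small constants depending only on Emax,
   C_K and C_D.

   All the forms are finite sums of the two forms (p, q) |-> int int p q and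
   int int E p q on W = L^2_pi(Gamma, L^2(D)), evaluated at the components of
   gradients and strains, which belong to W. *)
Require Import Defs.
From mathcomp Require Import all_boot all_order all_algebra.
From mathcomp Require Import all_classical all_reals all_analysis.
From mathcomp Require Import measurable_realfun ess_sup_inf ring lra.
Set Implicit Arguments.
Unset Strict Implicit.
Unset Printing Implicit Defensive.
Import Order.TTheory GRing.Theory Num.Theory.
Import numFieldNormedType.Exports.
Local Open Scope classical_set_scope.
Local Open Scope ring_scope.

(** * Semi-inner products *)

(** Two obstacles shape the development. First, an element of [W] maps [y] to a function of [x] and
    is approximated in norm for each [y]; it need not be jointly measurable, so Fubini's theorem
    cannot be applied to it. Measurability in [y] of an inner integral is obtained from that of
    norms by polarisation, and with the weight [E] from the affine dependence of [E] on [y]; only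
    the bounds on [E] itself are passed from the product measure to its sections. As a
    non-integrable function has a default integral, each form is linear only where integrability has
    been proved. Second, [C1] and [C2] are fixed before [Emin], [nu] and the domain. Both s and t
    are proportional to [Emin], so every gain carries the factor [Emin] of the conclusion, while
    [Emin <= Emax] bounds their sizes by [Emax]. The factor 1 / alpha in s fits the weights of the
    norm: alpha |s grad w|^2 <= (alpha s)^2 |p|^2 / alpha, and |p|^2 / alpha is part of the squared
    norm. *)

Definition linear_subspace {R : realType} {X : lmodType R} (Z : set X) : Prop :=
  Z 0 /\ forall a x y, Z x -> Z y -> Z (a *: x + y).

Section subspace_theory.
Context {R : realType} {X : lmodType R} (Z : set X).
Hypothesis ZS : linear_subspace Z.

Lemma subspaceD x y : Z x -> Z y -> Z (x + y).
Proof. by move=> Zx Zy; rewrite -[x]scale1r; exact: ZS.2. Qed.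

Lemma subspaceZ a x : Z x -> Z (a *: x).
Proof. by move=> Zx; rewrite -[a *: x]addr0; apply: ZS.2 => //; exact: ZS.1. Qed.

Lemma subspaceB x y : Z x -> Z y -> Z (x - y).
Proof. by move=> Zx Zy; rewrite addrC -scaleN1r; exact: ZS.2. Qed.

End subspace_theory.

(** The norms in use are square roots, hence nonnegative everywhere; homogeneity and the triangle
    inequality rest on integrability and are asked on [Z] only. *)
Record seminorm_on {R : realType} {X : lmodType R} (Z : set X)
    (N : X -> R) : Prop := SeminormOn {
  seminorm_ge0 : forall x, 0 <= N x;
  seminormZ : forall a x, Z x -> N (a *: x) = `|a| * N x;
  seminormD : forall x y, Z x -> Z y -> N (x + y) <= N x + N y }.

(** Definiteness is left out because elements are functions and not classes: one that vanishes
    almost everywhere has norm 0. *)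
Record semi_inner {R : realType} {X : lmodType R} (Z : set X)
    (f : X -> X -> R) : Prop := SemiInner {
  semi_innerP : forall a x y z, Z x -> Z y -> Z z ->
    f (a *: x + y) z = a * f x z + f y z;
  semi_innerC : forall x y, Z x -> Z y -> f x y = f y x;
  semi_inner_ge0 : forall x, Z x -> 0 <= f x x }.

Section semi_inner_theory.
Context {R : realType} {X : lmodType R} (Z : set X) (f : X -> X -> R).
Hypothesis ZS : linear_subspace Z.
Hypothesis fI : semi_inner Z f.

Lemma semi_innerPr a x y z : Z x -> Z y -> Z z ->
  f z (a *: x + y) = a * f z x + f z y.
Proof.
move=> Zx Zy Zz; rewrite (semi_innerC fI) ?(semi_innerP fI)//; last exact: ZS.2.
by rewrite !(semi_innerC fI (y := z)).
Qed.

Lemma semi_innerPP a x y : Z x -> Z y ->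
  f (a *: x + y) (a *: x + y) = a ^+ 2 * f x x + 2 * a * f x y + f y y.
Proof.
move=> Zx Zy; have Zxy := ZS.2 a _ _ Zx Zy.
rewrite (semi_innerP fI)// !semi_innerPr// (semi_innerC fI (x := y) (y := x))//.
ring.
Qed.

Lemma semi_inner0 z : Z z -> f 0 z = 0.
Proof.
move=> Zz; have Z0 := ZS.1; have := semi_innerP fI 1 Z0 Z0 Zz.
rewrite scale1r addr0 mul1r; lra.
Qed.

Lemma semi_innerZ a x z : Z x -> Z z -> f (a *: x) z = a * f x z.
Proof.
move=> Zx Zz; have Z0 := ZS.1.
by rewrite -[a *: x]addr0 (semi_innerP fI)// semi_inner0// addr0.
Qed.

Lemma semi_innerZZ a x : Z x -> f (a *: x) (a *: x) = a ^+ 2 * f x x.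
Proof.
move=> Zx; have Zax := subspaceZ ZS a Zx.
by rewrite semi_innerZ// (semi_innerC fI)// semi_innerZ// mulrA -expr2.
Qed.

Lemma semi_innerPP_le a x y : Z x -> Z y ->
  f (a *: x + y) (a *: x + y) <= 2 * a ^+ 2 * f x x + 2 * f y y.
Proof.
(* Nonnegativity at [- a *: x + y] bounds the cross term [2 * a * f x y] by the two squares. *)
move=> Zx Zy; have := semi_inner_ge0 fI (ZS.2 (- a) _ _ Zx Zy).
rewrite !semi_innerPP//; lra.
Qed.

Lemma cauchy_schwarz x y : Z x -> Z y -> f x y ^+ 2 <= f x x * f y y.
Proof.
move=> Zx Zy.
have P t : 0 <= t ^+ 2 * f x x + 2 * t * f x y + f y y.
  by rewrite -semi_innerPP//; apply: (semi_inner_ge0 fI); exact: ZS.2.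
have [fx0|fxN0] := eqVneq (f x x) 0.
  have [->|fxy0] := eqVneq (f x y) 0; first by rewrite fx0 expr0n mul0r.
  (* With [f x x = 0] the polynomial in [t] is affine, and at this [t] it equals -1. *)
  have := P (- (f y y + 1) / (2 * f x y)); rewrite fx0 mulr0 add0r.
  rewrite (_ : 2 * _ * _ = - (f y y + 1)); first lra.
  by field.
have fx0 : 0 < f x x by rewrite lt_def fxN0 (semi_inner_ge0 fI).
(* This is the minimiser of the quadratic in [t]. *)
have := P (- f x y / f x x).
rewrite (_ : _ + _ = (f x x * f y y - f x y ^+ 2) / f x x); last by field.
by rewrite pmulr_lge0 ?invr_gt0// subr_ge0.
Qed.

Lemma semi_inner_le_sqrt x y : Z x -> Z y ->
  `|f x y| <= Num.sqrt (f x x) * Num.sqrt (f y y).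
Proof.
move=> Zx Zy; rewrite -sqrtrM ?(semi_inner_ge0 fI)// -sqrtr_sqr.
by rewrite ler_wsqrtr// cauchy_schwarz.
Qed.

Lemma semi_inner_seminorm : seminorm_on Z (fun x => Num.sqrt (f x x)).
Proof.
split=> [x|a x Zx|x y Zx Zy]; first exact: sqrtr_ge0.
  by rewrite semi_innerZZ// sqrtrM ?sqr_ge0// sqrtr_sqr.
have := semi_innerPP 1 Zx Zy; rewrite scale1r => ->.
have fx := semi_inner_ge0 fI Zx; have fy := semi_inner_ge0 fI Zy.
rewrite -(@ler_pXn2r _ 2) ?nnegrE ?addr_ge0 ?sqrtr_ge0//.
have /(le_trans (ler_norm _)) := semi_inner_le_sqrt Zx Zy.
rewrite sqr_sqrtr; last first.
  by rewrite -(semi_innerPP 1)//; apply: (semi_inner_ge0 fI); exact: ZS.2.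
rewrite sqrrD !sqr_sqrtr//; lra.
Qed.

End semi_inner_theory.

(** Lifts a scalar form on [W] to gradients and strains, with [P i] the extraction of a
    component. *)
Lemma semi_inner_sum {R : realType} {X Y : lmodType R} (Z : set X) (Z' : set Y)
    (g : Y -> Y -> R) (I : finType) (P : I -> X -> Y) :
  semi_inner Z' g ->
  (forall i a x y, P i (a *: x + y) = a *: P i x + P i y) ->
  (forall i x, Z x -> Z' (P i x)) ->
  semi_inner Z (fun x y => \sum_i g (P i x) (P i y)).
Proof.
move=> gI Plin PZ; split=> [a x y z Zx Zy Zz|x y Zx Zy|x Zx].
- rewrite mulr_sumr -big_split; apply: eq_bigr => i _.
  by rewrite Plin (semi_innerP gI)//; exact: PZ.
- by apply: eq_bigr => i _; rewrite (semi_innerC gI)//; exact: PZ.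
- by apply: sumr_ge0 => i _; apply: (semi_inner_ge0 gI); exact: PZ.
Qed.

(** * Square-integrable functions *)

Section Rintegral_extra.
Context d (T : measurableType d) (R : realType).
Variable mu : {measure set T -> \bar R}.
Implicit Types f g : T -> R.

Lemma Rintegral_sum (I : Type) (s : seq I) (F : I -> T -> R) :
  (forall i, mu.-integrable setT (EFin \o F i)) ->
  \int[mu]_x (\sum_(i <- s) F i x) = \sum_(i <- s) \int[mu]_x F i x.
Proof.
move=> iF; elim: s => [|i s ih].
  under eq_Rintegral do rewrite big_nil.
  by rewrite Rintegral_cst// mul0r big_nil.
under eq_Rintegral do rewrite big_cons.
rewrite big_cons RintegralD ?ih//.
rewrite (_ : EFin \o _ = fun x => (\sum_(j <- s) (F j x)%:E)%E).
  by apply: integrable_sum => // j _; exact: iF.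
by apply/funext => x /=; rewrite sumEFin.
Qed.

Lemma integrableZ_EFin (a : R) f : mu.-integrable setT (EFin \o f) ->
  mu.-integrable setT (EFin \o (fun x => a * f x)).
Proof.
move=> fi; rewrite (_ : _ \o _ = (fun x => a%:E * (EFin \o f) x)%E).
  exact: integrableZl.
by apply/funext => x.
Qed.

Lemma integrableD_EFin f g : mu.-integrable setT (EFin \o f) ->
  mu.-integrable setT (EFin \o g) ->
  mu.-integrable setT (EFin \o (fun x => f x + g x)).
Proof. by move=> fi gi; exact: (integrableD measurableT fi gi). Qed.

Lemma ae_eq_Rintegral f g : measurable_fun setT f -> measurable_fun setT g ->
  {ae mu, forall x, f x = g x} -> \int[mu]_x f x = \int[mu]_x g x.
Proof.
move=> mf mg fg; congr fine; apply: ae_eq_integral => //.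
- exact/measurable_EFinP.
- exact/measurable_EFinP.
- by apply: filterS fg => x -> _.
Qed.

Lemma ae_le_Rintegral f g :
  mu.-integrable setT (EFin \o f) -> mu.-integrable setT (EFin \o g) ->
  {ae mu, forall x, f x <= g x} -> \int[mu]_x f x <= \int[mu]_x g x.
Proof.
move=> fi gi fg; rewrite -subr_ge0 -RintegralB//.
have mf : measurable_fun setT f by apply/measurable_EFinP/(measurable_int mu).
have mg : measurable_fun setT g by apply/measurable_EFinP/(measurable_int mu).
(* The sign of [g x - f x] is known almost everywhere only; the absolute value agrees with it there
   and is nonnegative at every point. *)
rewrite (@ae_eq_Rintegral _ (fun x => `|g x - f x|)).
- by apply: Rintegral_ge0 => x _; rewrite normr_ge0.
- exact: measurable_funB.
- by apply: measurableT_comp => //; exact: measurable_funB.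
- by apply: filterS fg => x fgx; rewrite ger0_norm// subr_ge0.
Qed.

Lemma ae_integrable_le f g : measurable_fun setT f ->
  mu.-integrable setT (EFin \o g) ->
  {ae mu, forall x, `|f x| <= g x} -> mu.-integrable setT (EFin \o f).
Proof.
move=> mf /integrableP[mg ig] fg; apply/integrableP; split.
  exact/measurable_EFinP.
apply: le_lt_trans ig; apply: ae_ge0_le_integral => //.
- by apply: measurableT_comp => //; exact/measurable_EFinP.
- by apply: measurableT_comp.
- by apply: filterS fg => x fgx _; rewrite lee_fin (le_trans fgx)// ler_norm.
Qed.

End Rintegral_extra.

Section square_integrable.
Context d (T : measurableType d) (R : realType).
Variable mu : {measure set T -> \bar R}.
Implicit Types f g c : T -> R.

(** For the measure [leb_on D] this is convertible with [L2 D], so the results below apply to [L2 D]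
    as they stand. *)
Definition sqint : set (T -> R) := [set f | f \in Lfun mu 2%:E].

Definition dot f g : R := \int[mu]_x (f x * g x).

Lemma sqint_subspace : linear_subspace sqint.
Proof.
have [S0 SP] := @Lfun_submod_closed _ _ _ mu 2%:E (lee1n 2).
by split; [exact: S0|move=> a x y; exact: SP].
Qed.

Lemma sqint_measurable f : sqint f -> measurable_fun setT f.
Proof. by rewrite /sqint/= inE => /andP[]; rewrite inE. Qed.

Lemma sqintP f : sqint f <->
  measurable_fun setT f /\ mu.-integrable setT (EFin \o (fun x => f x ^+ 2)).
Proof.
split=> [fS|[mf /integrableP[_ fi]]].
  by split; [exact: sqint_measurable|exact: Lfun2_integrable_sqr].
rewrite /sqint/= inE; apply/andP; split; rewrite inE//= /finite_norm unlock /Lnorm.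
apply: poweR_lty; apply: le_lt_trans fi.
under eq_integral do rewrite /= powR_mulrn// -normrX -abse_EFin.
by [].
Qed.

Lemma sqint_mul f g : sqint f -> sqint g ->
  mu.-integrable setT (EFin \o (fun x => f x * g x)).
Proof. by move=> fS gS; apply/Lfun1_integrable; exact: Lfun2_mul_Lfun1. Qed.

Lemma dot_semi_inner : semi_inner sqint dot.
Proof.
split=> [a f g h fS gS hS|f g _ _|f _].
- rewrite /dot -RintegralZl//; last exact: sqint_mul.
  rewrite -RintegralD//; first by apply: eq_Rintegral => x _; rewrite mulrDl mulrA.
  + exact/integrableZ_EFin/sqint_mul.
  + exact: sqint_mul.
- by apply: eq_Rintegral => x _; rewrite mulrC.
- by apply: Rintegral_ge0 => x _; rewrite -expr2 sqr_ge0.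
Qed.

Definition ess_bounded c (K : R) : Prop :=
  measurable_fun setT c /\ {ae mu, forall x, `|c x| <= K}.

Lemma Lfuny_ess_bounded c : c \in Lfun mu +oo%E -> exists K, ess_bounded c K.
Proof.
rewrite inE => /andP[/[!inE]/= mc]; rewrite /finite_norm unlock /Lnorm.
case: ifPn => [mu0|].
  by move=> /ess_supr_bounded[K cK]; exists K; split.
(* On a space of measure zero the norm is 0 by convention and says nothing about [c]; there the
   whole space is a null set and any bound holds. *)
rewrite -leNgt => mu0 _; exists 0; split => //.
exists setT; split => //.
by apply/eqP; rewrite eq_le measure_ge0 andbT.
Qed.

Lemma ess_bounded_mul c f K : ess_bounded c K -> sqint f ->
  sqint (c \* f) /\ dot (c \* f) (c \* f) <= K ^+ 2 * dot f f.
Proof.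
move=> [mc cK] fS; have mf := sqint_measurable fS.
have fi : mu.-integrable setT (EFin \o (fun x => K ^+ 2 * f x ^+ 2)).
  by apply: integrableZ_EFin; have /sqintP[] := fS.
have cf : {ae mu, forall x, (c x * f x) ^+ 2 <= K ^+ 2 * f x ^+ 2}.
  apply: filterS cK => x cK; rewrite exprMn ler_wpM2r ?sqr_ge0//.
  by rewrite -real_normK ?num_real// lerXn2r ?nnegrE ?(le_trans _ cK).
have cfS : sqint (c \* f).
  apply/sqintP; split; first exact: measurable_funM.
  apply: ae_integrable_le fi _.
    by apply: measurable_funX; exact: measurable_funM.
  by apply: filterS cf => x; rewrite ger0_norm// sqr_ge0.
split => //; have [_ cfi] := (sqintP (c \* f)).1 cfS.
have [_ f2i] := (sqintP f).1 fS.
rewrite /dot; under eq_Rintegral do rewrite -expr2.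
under [X in _ <= _ * X]eq_Rintegral do rewrite -expr2.
by rewrite -RintegralZl//; exact: ae_le_Rintegral.
Qed.

End square_integrable.

(** * Bochner spaces *)

Section simple_maps.
Context {R : realType} (M : nat).

(** The preimage of a value is a finite union of intersections of level sets. Taking [t] equal to
    [s] and an [h] that ignores its second argument gives the image under a single map. *)
Lemma simple_map2 (X Y U : zmodType) (A : set X) (B : set Y) (C : set U)
    (h : X -> Y -> U) (s : 'rV[R]_M -> X) (t : 'rV[R]_M -> Y) :
  (forall x y, A x -> B y -> C (h x y)) ->
  simple A s -> simple B t -> simple C (fun y => h (s y) (t y)).
Proof.
move=> hC [fs sA ms] [ft tB mt]; split.
- apply: (@sub_finite_set _ _ ((fun p => h p.1 p.2) @` (range s `*` range t))).
    by move=> _ [y _ <-]; exists (s y, t y) => //; split; exists y.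
  by apply: finite_image; exact: finite_setX.
- by move=> _ [y _ <-]; apply: hC; [apply: sA|apply: tB]; exists y.
- move=> z.
  pose I := (range s `*` range t) `&` [set p | h p.1 p.2 = z].
  rewrite (_ : _ @^-1` _ =
      \bigcup_(p in I) (s @^-1` [set p.1] `&` t @^-1` [set p.2])).
    apply: fin_bigcup_measurable; last by move=> p _; exact: measurableI.
    by apply: finite_setIl; exact: finite_setX.
  apply/seteqP; split=> [y /= hz|y [[a b] [_ /= <-] [/= -> ->]]//].
  by exists (s y, t y) => //; split => //; split; exists y.
Qed.

Lemma simple_measurable (A : set R) (s : 'rV[R]_M -> R) :
  simple A s -> measurable_fun setT s.
Proof.
move=> [fs _ ms] _ B mB; rewrite setTI.
rewrite (_ : _ @^-1` _ = \bigcup_(z in range s `&` B) (s @^-1` [set z])).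
  by apply: fin_bigcup_measurable => //; exact: finite_setIl.
apply/seteqP; split=> [y By|y [z [_ Bz] /= ->]//].
by exists (s y) => //; split => //; exists y.
Qed.

End simple_maps.

Section seminorm_theory.
Context {R : realType} {X : lmodType R} (Z : set X) (N : X -> R).
Hypotheses (ZS : linear_subspace Z) (NS : seminorm_on Z N).

Lemma seminorm_opp x : Z x -> N (- x) = N x.
Proof. by move=> Zx; rewrite -scaleN1r (seminormZ NS)// normrN1 mul1r. Qed.

Lemma seminorm_dist x y : Z x -> Z y -> `|N x - N y| <= N (x - y).
Proof.
move=> Zx Zy.
have H a b : Z a -> Z b -> N a - N b <= N (a - b).
  move=> Za Zb; rewrite lerBlDr -{1}(subrK b a).
  by apply: (seminormD NS) => //; exact: subspaceB.
rewrite ler_norml H// andbT lerNl opprB.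
by rewrite -(seminorm_opp (subspaceB ZS Zx Zy)) opprB H.
Qed.

Lemma seminormP a x y : Z x -> Z y -> N (a *: x + y) <= `|a| * N x + N y.
Proof.
move=> Zx Zy; rewrite -(seminormZ NS)//.
by apply: (seminormD NS) => //; exact: subspaceZ.
Qed.

Lemma seminormP_sqr a x y : Z x -> Z y ->
  N (a *: x + y) ^+ 2 <= 2 * a ^+ 2 * N x ^+ 2 + 2 * N y ^+ 2.
Proof.
move=> Zx Zy.
apply: (@le_trans _ _ ((`|a| * N x + N y) ^+ 2)).
  rewrite lerXn2r ?nnegrE ?(seminorm_ge0 NS)//; last exact: seminormP.
  by rewrite addr_ge0// ?mulr_ge0// (seminorm_ge0 NS).
rewrite -[a ^+ 2]real_normK ?num_real//.
(* The square of the difference bounds the cross term of the square of the sum. *)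
have := sqr_ge0 (`|a| * N x - N y); rewrite !sqrrD sqrrN exprMn; lra.
Qed.

End seminorm_theory.

Section bochner_theory.
Context {R : realType} (M : nat) {X : lmodType R} (Z : set X) (N : X -> R).
Hypotheses (ZS : linear_subspace Z) (NS : seminorm_on Z N).
Implicit Types u v : 'rV[R]_M -> X.

Lemma strongly_measurable_lin a u v :
  (forall y, Z (u y)) -> (forall y, Z (v y)) ->
  strongly_measurable Z N u -> strongly_measurable Z N v ->
  strongly_measurable Z N (fun y => a *: u y + v y).
Proof.
move=> Zu Zv [s [ss su]] [t [st tv]].
exists (fun n y => a *: s n y + t n y); split=> [n|y].
  apply: (simple_map2 (h := fun x z => a *: x + z) _ (ss n) (st n)).
  exact: ZS.2.
have Zs n : Z (s n y) by have [_ + _] := ss n; apply; exists y.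
have Zt n : Z (t n y) by have [_ + _] := st n; apply; exists y.
apply: (@squeeze_cvgr _ _ _ _ (cst 0)
   (fun n => `|a| * N (u y - s n y) + N (v y - t n y))).
- near=> n; rewrite (seminorm_ge0 NS)/=.
  rewrite opprD addrACA -scalerBr.
  by apply: (seminormP ZS NS); exact: subspaceB.
- exact: cvg_cst.
- have := cvgD (cvgM (cvg_cst `|a|) (su y)) (tv y).
  by rewrite mulr0 addr0; exact.
Unshelve. all: by end_near. Qed.

(** By the reverse triangle inequality the simple scalar functions [N (s n y)] converge pointwise to
    [N (u y)]. *)
Lemma measurable_seminorm u : (forall y, Z (u y)) ->
  strongly_measurable Z N u -> measurable_fun setT (fun y => N (u y)).
Proof.
move=> Zu [s [ss su]].
have Zs n y : Z (s n y) by have [_ + _] := ss n; apply; exists y.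
apply: (measurable_fun_cvg (h := fun n y => N (s n y))) => [n|y _].
  apply: (@simple_measurable _ _ setT).
  exact: (simple_map2 (h := fun x _ => N x) _ (ss n) (ss n)).
apply/cvgrPdist_le => e e0.
have /cvgrPdist_le/(_ _ e0) := su y; apply: filterS => n.
rewrite sub0r normrN ger0_norm ?(seminorm_ge0 NS)//.
by apply: le_trans; exact: (seminorm_dist ZS NS).
Qed.

Lemma bochnerL2_integrable u : bochnerL2 Z N u ->
  (pi_Gamma R M).-integrable setT (EFin \o (fun y => N (u y) ^+ 2)).
Proof.
move=> [Zu mu iu]; apply/integrableP; split.
  by apply/measurable_EFinP; apply: measurable_funX; exact: measurable_seminorm.
by under eq_integral do rewrite gee0_abs ?lee_fin ?sqr_ge0//.
Qed.

Lemma bochnerL2_subspace : linear_subspace (@bochnerL2 R M X Z N).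
Proof.
split.
  have N0 : N 0 = 0.
    by rewrite -(scale0r 0) (seminormZ NS) ?normr0 ?mul0r//; exact: ZS.1.
  split=> [y||]; first exact: ZS.1.
    exists (fun _ _ => 0); split=> [n|y].
      split=> [|_ [y _ <-]|z]; last 2 first.
      - exact: ZS.1.
      - have [->|z0] := eqVneq z 0.
          by rewrite preimage_cst mem_set.
        rewrite preimage_cst memNset//= => z00.
        by rewrite -z00 eqxx in z0.
      by apply: (@sub_finite_set _ _ [set 0]) => // _ [y _ <-].
    by rewrite subr0 N0; exact: cvg_cst.
  under eq_integral do rewrite N0 expr0n.
  by rewrite integral0.
move=> a u v Bu Bv; have [Zu mu iu] := Bu; have [Zv mv iv] := Bv; split.
- by move=> y; apply: ZS.2.
- exact: strongly_measurable_lin.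
- have /= mN := measurable_seminorm _ (strongly_measurable_lin a Zu Zv mu mv).
  have iu' := integrableZ_EFin (2 * a ^+ 2) (bochnerL2_integrable Bu).
  have iv' := integrableZ_EFin 2 (bochnerL2_integrable Bv).
  have iuv := integrableD_EFin iu' iv'.
  have := integrable_lty measurableT iuv.
  apply: le_lt_trans; apply: ge0_le_integral => //.
  + by move=> y _; rewrite lee_fin sqr_ge0.
  + apply/measurable_EFinP; apply: measurable_funX; apply: mN => y.
    exact: ZS.2.
  + by have /integrableP[] := iuv.
  + by move=> y _; rewrite lee_fin; exact: (seminormP_sqr ZS NS).
Qed.

End bochner_theory.

Section bochner_map.
Context {R : realType} (M : nat) {X Y : lmodType R}.
Variables (Z : set X) (N : X -> R) (Z' : set Y) (N' : Y -> R).
Hypotheses (ZS : linear_subspace Z) (NS : seminorm_on Z N).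
Hypotheses (Z'S : linear_subspace Z') (N'S : seminorm_on Z' N').

(** A bounded linear map carries approximating simple functions to approximating simple functions.
    It is applied to multiplication by a bounded coefficient and to the extraction of a gradient
    component. *)
Lemma bochnerL2_map (P : X -> Y) (C : R) (u : 'rV[R]_M -> X) :
  (forall a x y, P (a *: x + y) = a *: P x + P y) ->
  (forall x, Z x -> Z' (P x)) -> (forall x, Z x -> N' (P x) <= C * N x) ->
  bochnerL2 Z N u -> bochnerL2 Z' N' (fun y => P (u y)).
Proof.
move=> Plin PZ PN Bu; have [Zu mu iu] := Bu.
have PB x y : P (x - y) = P x - P y.
  by rewrite addrC -scaleN1r Plin scaleN1r addrC.
have Z'Pu y : Z' (P (u y)) by exact: PZ.
have mPu : strongly_measurable Z' N' (fun y => P (u y)).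
  have [s [ss su]] := mu.
  have Zs n y : Z (s n y) by have [_ + _] := ss n; apply; exists y.
  exists (fun n z => P (s n z)); split=> [n|y].
    apply: (simple_map2 (h := fun x _ => P x) _ (ss n) (ss n)) => x ? Zx _.
    exact: PZ.
  apply: (@squeeze_cvgr _ _ _ _ (cst 0) (fun n => C * N (u y - s n y))).
  - near=> n; rewrite (seminorm_ge0 N'S)/= -PB PN//.
    exact: subspaceB.
  - exact: cvg_cst.
  - by have := cvgM (cvg_cst C) (su y); rewrite mulr0; exact.
split => //.
have mN' := measurable_seminorm Z'S N'S Z'Pu mPu.
have iu' := integrableZ_EFin (C ^+ 2) (bochnerL2_integrable ZS NS Bu).
have := integrable_lty measurableT iu'.
apply: le_lt_trans; apply: ge0_le_integral => //.
- by move=> y _; rewrite lee_fin sqr_ge0.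
- by apply/measurable_EFinP; exact: measurable_funX.
- by have /integrableP[] := iu'.
- move=> y _; rewrite lee_fin -exprMn lerXn2r ?nnegrE ?(seminorm_ge0 N'S)//.
    by rewrite (le_trans _ (PN _ (Zu y)))// (seminorm_ge0 N'S).
  exact: PN.
Unshelve. all: by end_near. Qed.

End bochner_map.

Section bochner_inner.
Context {R : realType} (M : nat) {X : lmodType R}.
Variables (Z : set X) (f : X -> X -> R).
Hypotheses (ZS : linear_subspace Z) (fI : semi_inner Z f).
Local Notation N := (fun x => Num.sqrt (f x x)).
Let NS : seminorm_on Z N := semi_inner_seminorm ZS fI.
Implicit Types u v : 'rV[R]_M -> X.

(** Strong measurability gives measurability of norms only; the polarisation identity writes the
    product in terms of three norms. *)
Lemma bochner_inner_measurable u v : bochnerL2 Z N u -> bochnerL2 Z N v ->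
  measurable_fun setT (fun y => f (u y) (v y)).
Proof.
move=> Bu Bv; have [Zu mu _] := Bu; have [Zv mv _] := Bv.
have [Zuv muv _] := (bochnerL2_subspace M ZS NS).2 1 _ _ Bu Bv.
have Nu := measurable_seminorm ZS NS Zu mu.
have Nv := measurable_seminorm ZS NS Zv mv.
have Nuv := measurable_seminorm ZS NS Zuv muv.
rewrite (_ : (fun y => _) = (fun y => 2^-1 *
    (N (1 *: u y + v y) ^+ 2 - N (u y) ^+ 2 - N (v y) ^+ 2))).
  apply: measurable_funM => //; apply: measurable_funB.
    by apply: measurable_funB; exact: measurable_funX.
  exact: measurable_funX.
apply/funext => y; rewrite !sqr_sqrtr ?(semi_inner_ge0 fI)//; last first.
  exact: Zuv.
by rewrite (semi_innerPP ZS fI)//; field.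
Qed.

Lemma bochner_inner_integrable u v : bochnerL2 Z N u -> bochnerL2 Z N v ->
  (pi_Gamma R M).-integrable setT (EFin \o (fun y => f (u y) (v y))).
Proof.
move=> Bu Bv; have [Zu _ _] := Bu; have [Zv _ _] := Bv.
have iuv := integrableD_EFin (bochnerL2_integrable ZS NS Bu)
  (bochnerL2_integrable ZS NS Bv).
apply: ae_integrable_le iuv _; first exact: bochner_inner_measurable.
apply: nearW => y.
apply: (le_trans (semi_inner_le_sqrt ZS fI (Zu y) (Zv y))).
set a := Num.sqrt _; set b := Num.sqrt _.
have := sqr_ge0 (a - b); have := sqr_ge0 (a + b).
rewrite sqrrB sqrrD; lra.
Qed.

End bochner_inner.

(** * The weighted forms on W *)

Lemma ae_ysection d1 d2 (T1 : measurableType d1) (T2 : measurableType d2)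
    (R : realType) (m1 : {sigma_finite_measure set T1 -> \bar R})
    (m2 : {sigma_finite_measure set T2 -> \bar R}) (P : T1 * T2 -> Prop) :
  {ae (m1 \x m2)%E, forall z, P z} ->
  {ae m2, forall y, {ae m1, forall x, P (x, y)}}.
Proof.
move=> [A [mA A0 PA]].
have : (m1 \x^ m2)%E A = 0%E.
  (* The product measure integrates the measures of x-sections, whereas y-sections are wanted; by
     uniqueness the other iterated integral is the same measure. A nonnegative function with
     integral 0 then vanishes almost everywhere. *)
  rewrite -A0; apply/esym; apply: product_measure_unique => // B C mB mC.
  exact: product_measure2E.
rewrite /product_measure2 => iA.
have : ae_eq m2 setT (m1 \o ysection A) (cst 0%E).
  apply/ae_eq_integral_abs => //; first exact: measurable_fun_ysection.
  by under eq_integral do rewrite gee0_abs//.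
apply: filterS => y /(_ I) /= Ay.
exists (ysection A y); split => //; first exact: measurable_ysection.
by move=> x /= nP; rewrite /ysection/= mem_set//; exact: PA.
Qed.

Section weighted.
Context {R : realType} {d : nat} (D : domain R d) (M : nat).
Local Notation mu := (leb_on D).
Local Notation W := (@W R d D M).
Implicit Types p q : 'rV[R]_M -> 'rV[R]_d -> R.

Let LS := sqint_subspace mu.
Let LI := dot_semi_inner mu.
(** Holds by conversion: [p x ^+ 2] unfolds to [p x * p x], so [normL2 D p] is the square root of
    [dot mu p p]. *)
Let NS : seminorm_on (L2 D) (normL2 D) := semi_inner_seminorm LS LI.

Lemma W_subspace : linear_subspace W.
Proof. exact: (bochnerL2_subspace M LS NS). Qed.

Definition iprod p q : R := \int[pi_Gamma R M]_y \int[mu]_x (p y x * q y x).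

Lemma W_dot_integrable p q : W p -> W q ->
  (pi_Gamma R M).-integrable setT (EFin \o (fun y => dot mu (p y) (q y))).
Proof. exact: (bochner_inner_integrable LS LI). Qed.

Lemma iprod_semi_inner : semi_inner W iprod.
Proof.
split=> [a p q r Wp Wq Wr|p q Wp Wq|p [Wp _ _]].
- have [Lp _ _] := Wp; have [Lq _ _] := Wq; have [Lr _ _] := Wr.
  rewrite /iprod -RintegralZl//; last exact: (W_dot_integrable Wp Wr).
  rewrite -RintegralD//.
  + by apply: eq_Rintegral => y _; exact: (semi_innerP LI a (Lp y) (Lq y) (Lr y)).
  + exact: (integrableZ_EFin a (W_dot_integrable Wp Wr)).
  + exact: (W_dot_integrable Wq Wr).
- by apply: eq_Rintegral => y _; apply: eq_Rintegral => x _; rewrite mulrC.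
- by apply: Rintegral_ge0 => y _; exact: (semi_inner_ge0 LI (Wp y)).
Qed.

Lemma normW_iprod p : W p -> normW D p = Num.sqrt (iprod p p).
Proof.
move=> [Lp _ _]; congr Num.sqrt; apply: eq_Rintegral => y _.
by rewrite sqr_sqrtr//; exact: (semi_inner_ge0 LI (Lp y)).
Qed.

Lemma W_mul c K p : ess_bounded mu c K -> W p -> W (fun y => c \* p y).
Proof.
(* The sign of [K] is not prescribed by [ess_bounded]; the bound on squares yields the square root
   of [K ^+ 2]. *)
move=> cK; apply: (bochnerL2_map (C := `|K|) LS NS LS NS).
- move=> a f g; apply/funext => x /=.
  by rewrite mulrDr mulrCA.
- by move=> f Lf; have [] := ess_bounded_mul cK Lf.
- move=> f Lf; have [_ H] := ess_bounded_mul cK Lf.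
  rewrite -sqrtr_sqr -sqrtrM ?sqr_ge0// ler_wsqrtr//.
Qed.

Section young_weight.
Variables (e0 : 'rV[R]_d -> R) (e : 'I_M -> 'rV[R]_d -> R).
Hypotheses (e0oo : e0 \in Lfun mu +oo%E) (eoo : forall k, e k \in Lfun mu +oo%E).
Local Notation E := (young e0 e).

Definition wform p q : R :=
  \int[pi_Gamma R M]_y \int[mu]_x (E x y * p y x * q y x).

Lemma measurable_young y : measurable_fun setT (fun x => E x y).
Proof.
have [K [me _]] := Lfuny_ess_bounded e0oo.
apply: measurable_funD => //; apply: measurable_sum => k.
by have [Kk [mk _]] := Lfuny_ess_bounded (eoo k); exact: measurable_funM.
Qed.

(** Since [E] is affine in [y], the inner integral is a finite combination, with coefficients 1 and
    the coordinates of [y], of the products of [e0 \* p y] and [e k \* p y] with [q y], each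
    measurable in [y] by polarisation. *)
Lemma wform_measurable p q : W p -> W q ->
  measurable_fun setT (fun y => \int[mu]_x (E x y * p y x * q y x)).
Proof.
move=> Wp Wq; have [Lq _ _] := Wq.
have [K eK] := Lfuny_ess_bounded e0oo.
have W0 := W_mul eK Wp; have [L0 _ _] := W0.
have Wk k : W (fun y => e k \* p y).
  by have [Kk ek] := Lfuny_ess_bounded (eoo k); exact: (W_mul ek Wp).
rewrite (_ : (fun y => _) = (fun y => dot mu (e0 \* p y) (q y) +
   \sum_k rV_coord k y * dot mu (e k \* p y) (q y))).
  apply: measurable_funD.
    exact: (bochner_inner_measurable LS LI W0 Wq).
  apply: measurable_sum => k; apply: measurable_funM.
    exact: measurable_coord.
  exact: (bochner_inner_measurable LS LI (Wk k) Wq).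
apply/funext => y.
have Lk k : sqint mu (e k \* p y) by have [+ _ _] := Wk k; exact.
have ik k : mu.-integrable setT
    (EFin \o (fun x => rV_coord k y * ((e k \* p y) x * q y x))).
  exact: (integrableZ_EFin _ (sqint_mul (Lk k) (Lq y))).
transitivity (dot mu (e0 \* p y) (q y) +
    \sum_k \int[mu]_x (rV_coord k y * ((e k \* p y) x * q y x))); last first.
  congr (_ + _); apply: eq_bigr => k _.
  by rewrite RintegralZl//; exact: (sqint_mul (Lk k) (Lq y)).
rewrite -Rintegral_sum// /dot -RintegralD//.
- apply: eq_Rintegral => x _ /=; rewrite /young !mulrDl; congr (_ + _).
  rewrite !mulr_suml; apply: eq_bigr => k _.
  rewrite /rV_coord; ring.
- exact: (sqint_mul (L0 y) (Lq y)).
- rewrite (_ : EFin \o _ = fun x => (\sum_k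
    (rV_coord k y * ((e k \* p y) x * q y x))%:E)%E).
    by apply: integrable_sum => // k _; exact: ik.
  by apply/funext => x /=; rewrite sumEFin.
Qed.

Variables Emin Emax : R.
Hypothesis Emin_gt0 : 0 < Emin.
Hypothesis Ebnd : {ae (mu \x pi_Gamma R M)%E,
  forall z, Emin <= E z.1 z.2 <= Emax}.

Let Eae : {ae pi_Gamma R M, forall y, {ae mu, forall x, Emin <= E x y <= Emax}}.
Proof. exact: (ae_ysection Ebnd). Qed.

Let E_ess_bounded : {ae pi_Gamma R M, forall y,
  ess_bounded mu (fun x => E x y) Emax}.
Proof.
apply: filterS Eae => y Ey; split; first exact: measurable_young.
apply: filterS Ey => x /andP[Ex1 Ex2].
by rewrite ger0_norm// (le_trans _ Ex1)// ltW.
Qed.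

Lemma wform_integrable p q : W p -> W q -> (pi_Gamma R M).-integrable setT
  (EFin \o (fun y => \int[mu]_x (E x y * p y x * q y x))).
Proof.
move=> Wp Wq; have [Lp _ _] := Wp; have [Lq _ _] := Wq.
(* Dominating function: with |E p|^2 <= Emax^2 |p|^2 for almost every y, Cauchy-Schwarz gives |E p|
   |q| <= Emax^2 |p|^2 + |q|^2, which is at most (Emax^2 + 1) (|p|^2 + |q|^2). *)
have ipq := integrableZ_EFin (Emax ^+ 2 + 1)
  (integrableD_EFin (W_dot_integrable Wp Wp) (W_dot_integrable Wq Wq)).
apply: ae_integrable_le ipq _; first exact: wform_measurable.
apply: filterS E_ess_bounded => y Ey.
have [LE LEp] := ess_bounded_mul Ey (Lp y).
have := semi_inner_le_sqrt LS LI LE (Lq y); rewrite {1}/dot/=.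
move=> /le_trans; apply.
move: LEp; set a := dot _ _ _; set b := dot _ (p y) _; set c := dot _ (q y) _.
have a0 : 0 <= a by exact: (semi_inner_ge0 LI LE).
have b0 : 0 <= b by exact: (semi_inner_ge0 LI (Lp y)).
have c0 : 0 <= c by exact: (semi_inner_ge0 LI (Lq y)).
move=> ab; have := sqr_ge0 (Num.sqrt a - Num.sqrt c).
have : 0 <= Emax ^+ 2 * c by rewrite mulr_ge0// sqr_ge0.
have := mulr_ge0 (sqrtr_ge0 a) (sqrtr_ge0 c).
rewrite sqrrB !sqr_sqrtr//; lra.
Qed.

Lemma wform_bounds p : W p ->
  Emin * iprod p p <= wform p p <= Emax * iprod p p.
Proof.
move=> Wp; have [Lp _ _] := Wp.
have iE := wform_integrable Wp Wp.
have ip c := integrableZ_EFin c (W_dot_integrable Wp Wp).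
rewrite /iprod -!RintegralZl//; [|exact: (W_dot_integrable Wp Wp)..].
have p2i c y : mu.-integrable setT (EFin \o (fun x => c * (p y x * p y x))).
  exact: (integrableZ_EFin _ (sqint_mul (Lp y) (Lp y))).
have Epi y : ess_bounded mu (fun x => E x y) Emax ->
    mu.-integrable setT (EFin \o (fun x => E x y * p y x * p y x)).
  by move=> Ey; have [LE _] := ess_bounded_mul Ey (Lp y); exact: (sqint_mul LE (Lp y)).
apply/andP; split; apply: ae_le_Rintegral => //.
- exact: (ip Emin).
- apply: filterS2 Eae E_ess_bounded => y Ey Eb.
  rewrite -RintegralZl//; last exact: (sqint_mul (Lp y) (Lp y)).
  apply: ae_le_Rintegral; [exact: p2i|exact: Epi|].
  apply: filterS Ey => x /andP[Ex _].
  by rewrite -mulrA ler_wpM2r// -expr2 sqr_ge0.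
- exact: (ip Emax).
- apply: filterS2 Eae E_ess_bounded => y Ey Eb.
  rewrite -RintegralZl//; last exact: (sqint_mul (Lp y) (Lp y)).
  apply: ae_le_Rintegral; [exact: Epi|exact: p2i|].
  apply: filterS Ey => x /andP[_ Ex].
  by rewrite -mulrA ler_wpM2r// -expr2 sqr_ge0.
Qed.

Lemma wform_semi_inner : semi_inner W wform.
Proof.
split=> [a p q r Wp Wq Wr|p q Wp Wq|p Wp].
- have [Lp _ _] := Wp; have [Lq _ _] := Wq; have [Lr _ _] := Wr.
  have [WpqS _ _] := W_subspace.2 a _ _ Wp Wq.
  rewrite /wform -RintegralZl//; last exact: (wform_integrable Wp Wr).
  rewrite -RintegralD//; last 2 first.
  + exact: (integrableZ_EFin a (wform_integrable Wp Wr)).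
  + exact: (wform_integrable Wq Wr).
  apply: ae_eq_Rintegral.
  + exact: (wform_measurable (W_subspace.2 a _ _ Wp Wq) Wr).
  + apply: measurable_funD; last exact: (wform_measurable Wq Wr).
    by apply: measurable_funM => //; exact: (wform_measurable Wp Wr).
  apply: filterS E_ess_bounded => y Ey.
  have [LEp _] := ess_bounded_mul Ey (Lp y).
  have [LEq _] := ess_bounded_mul Ey (Lq y).
  have := semi_innerP LI a LEp LEq (Lr y); rewrite /dot /= => <-.
  apply: eq_Rintegral => x _ /=; congr (_ * _).
  by rewrite mulrDr mulrCA.
- apply: eq_Rintegral => y _; apply: eq_Rintegral => x _; ring.
- have /andP[+ _] := wform_bounds Wp; apply: le_trans.
  by rewrite mulr_ge0// ?(semi_inner_ge0 iprod_semi_inner)// ltW.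
Qed.

End young_weight.
End weighted.

(** * Lebesgue measure on the domain *)

Section box.
Context {R : realType}.

Definition box (n : nat) (K : R) : set 'rV[R]_n :=
  [set x | forall i, `[- K, K]%classic (x ord0 i)].

Lemma box_compact n K : compact (@box n K).
Proof.
by apply: (@rV_compact R n (fun=> `[- K, K]%classic)) => i; exact: segment_compact.
Qed.

Lemma measurable_box n K : measurable (@box n K).
Proof.
rewrite (_ : box K = \bigcap_(i in [set: 'I_n]) (rV_coord i @^-1` `[- K, K])).
  apply: fin_bigcap_measurable => // i _.
  by rewrite -[X in measurable X]setTI; exact: measurable_coord.
by apply/seteqP; split=> [x xK i _|x xK i]; exact: xK.
Qed.

Lemma leb_box n K : (leb R n (@box n K) < +oo)%E.
Proof.
have mI : measurable (`[- K, K]%classic : set (measurableTypeR R)) by [].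
have mB := @measurable_box.
elim: n => [|n ih]; first by rewrite /leb /= diracE ltry.
rewrite /leb/= /rV_measure_step /pushforward.
have -> : rV_cons @^-1` box K = `[- K, K]%classic `*` (@box n K).
  apply/seteqP; split=> [z zK|z [z1 z2] i]; last first.
    by rewrite rV_consE; case: unliftP => [j _|_]; [exact: z2|exact: z1].
  split; first by have := zK ord0; rewrite rV_consE unlift_none.
  by move=> i; have := zK (lift ord0 i); rewrite rV_consE liftK.
rewrite product_measure1E//; last exact: mB.
apply: lte_mul_pinfty => //; rewrite ge0_fin_numE//.
have /= -> := lebesgue_measure_itv `[- K, K].
by case: ifP => _; exact: ltry.
Qed.

End box.

Lemma bounded_sub_box (R : realType) (n : nat) (A : set 'rV[R]_n) :
  bounded_set A -> exists K, A `<=` box K.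
Proof.
(* [bounded_set] gives a bound by every number strictly above [K], not by [K] itself. *)
move=> [K [Kreal AK]]; exists (K + 1) => x Ax i.
rewrite /= in_itv/= -ler_norml.
apply: le_trans (AK _ _ _ Ax); last by rewrite ltrDl.
have /mapP[j Hj ->] : `|x ord0 i| \in [seq `|x z.1 z.2| | z : 'I_1 * 'I_n].
  by apply/mapP; exists (ord0, i) => //=; rewrite mem_enum.
by rewrite [leRHS]/Num.Def.normr /= mx_normrE; apply/bigmax_geP; right => /=; exists j.
Qed.

Lemma continuous_measurable_rV (R : realType) (n : nat) (f : 'rV[R]_n -> R) :
  continuous f -> measurable_fun setT f.
Proof.
move=> /continuousP cf; apply: (measurability _ (RGenOpens.measurableE R)).
move=> _ [_ [a [b ->] <-]]; rewrite setTI.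
by apply: open_measurable_rV; apply: cf.
Qed.

Section domain_theory.
Context {R : realType} {d : nat} (D : domain R d).
Local Notation mu := (leb_on D).

Lemma leb_on_setC : mu (~` (D : set _)) = 0%E.
Proof. by rewrite /leb_on /mrestr setICl measure0. Qed.

Lemma leb_on_fin : (mu setT < +oo)%E.
Proof.
have [K DK] := bounded_sub_box (dom_bounded D).
rewrite /leb_on /mrestr setTI; apply: le_lt_trans (leb_box d K).
rewrite le_measure// inE; first exact: (open_measurable_rV (dom_open D)).
exact: measurable_box.
Qed.

(** Compactness of a box around [D] bounds [f] there, and [leb_on D] is finite and ignores the
    complement of [D]. This makes test functions, the smooth approximants of traces and their
    derivatives square-integrable. *)
Lemma continuous_sqint f : continuous f -> sqint mu f.
Proof.
move=> cf; have mf := continuous_measurable_rV cf.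
have [K DK] := bounded_sub_box (dom_bounded D).
have /compact_bounded[C [Creal fC]] : compact (f @` @box R d K).
  by apply: continuous_compact (@box_compact R d K); exact: continuous_subspaceT.
have c2 : mu.-integrable setT (EFin \o cst ((C + 1) ^+ 2)).
  apply/integrableP; split; first by apply/measurable_EFinP.
  rewrite (eq_integral (cst `|((C + 1) ^+ 2)%:E|%E))//.
  by rewrite integral_cst//= lte_mul_pinfty ?leb_on_fin.
apply/sqintP; split => //; apply: ae_integrable_le c2 _.
  exact: measurable_funX.
exists (~` (D : set _)); split.
- by apply: measurableC; exact: (open_measurable_rV (dom_open D)).
- exact: leb_on_setC.
- move=> x /= nx Dx; apply: nx; rewrite ger0_norm ?sqr_ge0//.
  rewrite -real_normK ?num_real// lerXn2r ?nnegrE//.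
    by rewrite (le_trans (normr_ge0 (f x)))// fC ?ltrDl//; exists x => //; exact: DK.
  by rewrite fC ?ltrDl//; exists x => //; exact: DK.
Qed.

End domain_theory.

(** * Weak gradients and traces *)

Section frob_theory.
Context {R : realType} {m n : nat}.
Implicit Types A B C : 'M[R]_(m, n).

Lemma frobC A B : frob A B = frob B A.
Proof. by apply: eq_bigr => i _; apply: eq_bigr => j _; rewrite mulrC. Qed.

Lemma frobP a A B C : frob (a *: A + B) C = a * frob A C + frob B C.
Proof.
rewrite /frob mulr_sumr -big_split; apply: eq_bigr => i _ /=.
rewrite mulr_sumr -big_split; apply: eq_bigr => j _ /=.
by rewrite !mxE; ring.
Qed.

Lemma frob_ge0 A : 0 <= frob A A.
Proof. by do 2 apply: sumr_ge0 => ? _; rewrite -expr2 sqr_ge0. Qed.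

Lemma frob_coord A i j : A i j ^+ 2 <= frob A A.
Proof.
rewrite /frob (bigD1 i)//= (bigD1 j)//= -expr2 -addrA lerDl addr_ge0//.
  by apply: sumr_ge0 => k _; rewrite -expr2 sqr_ge0.
by do 2 apply: sumr_ge0 => ? _; rewrite -expr2 sqr_ge0.
Qed.

Lemma frobP_sqr a A B :
  frob (a *: A + B) (a *: A + B) <= 2 * a ^+ 2 * frob A A + 2 * frob B B.
Proof.
(* Expanding this square bounds the cross term, as in [semi_innerPP_le]. *)
have : 0 <= frob (- a *: A + B) (- a *: A + B) by exact: frob_ge0.
rewrite !frobP (frobC A (- a *: A + B)) (frobC B (- a *: A + B)) !frobP.
rewrite (frobC A (a *: A + B)) (frobC B (a *: A + B)) !frobP (frobC B A); lra.
Qed.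

Lemma measurable_frob d (T : measurableType d) (F G : T -> 'M[R]_(m, n)) :
  (forall i j, measurable_fun setT (fun x => F x i j)) ->
  (forall i j, measurable_fun setT (fun x => G x i j)) ->
  measurable_fun setT (fun x => frob (F x) (G x)).
Proof.
move=> mF mG; apply: measurable_sum => i; apply: measurable_sum => j.
exact: measurable_funM.
Qed.

Lemma integrable_frob d (T : measurableType d)
    (mu : {measure set T -> \bar R}) (F G : T -> 'M[R]_(m, n)) :
  (forall i j, sqint mu (fun x => F x i j)) ->
  (forall i j, sqint mu (fun x => G x i j)) ->
  mu.-integrable setT (EFin \o (fun x => frob (F x) (G x))).
Proof.
move=> SF SG.
rewrite (_ : EFin \o _ =
    fun x => (\sum_i \sum_j (F x i j * G x i j)%:E)%E); last first.
  by apply/funext => x /=; rewrite -sumEFin; apply: eq_bigr => i _; rewrite sumEFin.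
apply: integrable_sum => // i _; apply: integrable_sum => // j _.
exact: (sqint_mul (SF i j) (SG i j)).
Qed.

Lemma Rintegral_frob d (T : measurableType d)
    (mu : {measure set T -> \bar R}) (F G : T -> 'M[R]_(m, n)) :
  (forall i j, sqint mu (fun x => F x i j)) ->
  (forall i j, sqint mu (fun x => G x i j)) ->
  \int[mu]_x frob (F x) (G x) =
  \sum_i \sum_j \int[mu]_x (F x i j * G x i j).
Proof.
move=> SF SG; rewrite /frob Rintegral_sum.
  apply: eq_bigr => i _; rewrite Rintegral_sum// => j.
  exact: (sqint_mul (SF i j) (SG i j)).
move=> i; rewrite (_ : EFin \o _ =
    fun x => (\sum_j (F x i j * G x i j)%:E)%E).
  by apply: integrable_sum => // j _; exact: (sqint_mul (SF i j) (SG i j)).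
by apply/funext => x /=; rewrite sumEFin.
Qed.

End frob_theory.

Section H1_theory.
Context {R : realType} {d : nat} (D : domain R d).
Local Notation mu := (leb_on D).
Implicit Types w : H1rep R d.

(* [H1rep] pairs whose second component need not be the weak gradient of the
   first: on them [normH1] is already a seminorm. *)
Definition L2pair : set (H1rep R d) :=
  [set w : H1rep R d | (forall i, L2 D (fun x => w.1 x ord0 i)) /\
           (forall i j, L2 D (fun x => w.2 x i j))].

Let LS := sqint_subspace mu.

Lemma L2pair_subspace : linear_subspace L2pair.
Proof.
split.
  split=> [i|i j].
    rewrite (_ : (fun x => _) = 0); first exact: LS.1.
    by apply/funext => x; rewrite !mxE.
  rewrite (_ : (fun x => _) = 0); first exact: LS.1.
  by apply/funext => x; rewrite !mxE.
move=> a v w [v1 v2] [w1 w2]; split=> [i|i j].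
  rewrite (_ : (fun x => _) =
    a *: (fun x => v.1 x ord0 i) + (fun x => w.1 x ord0 i)).
    exact: (LS.2 a _ _ (v1 i) (w1 i)).
  by apply/funext => x; rewrite !mxE.
rewrite (_ : (fun x => _) =
  a *: (fun x => v.2 x i j) + (fun x => w.2 x i j)).
  exact: (LS.2 a _ _ (v2 i j) (w2 i j)).
by apply/funext => x; rewrite !mxE.
Qed.

Definition H1dot v w : R :=
  \int[mu]_x (frob (v.1 x) (w.1 x) + frob (v.2 x) (w.2 x)).

Lemma L2pair_integrable v w : L2pair v -> L2pair w ->
  mu.-integrable setT
    (EFin \o (fun x => frob (v.1 x) (w.1 x) + frob (v.2 x) (w.2 x))).
Proof.
move=> [v1 v2] [w1 w2]; apply: integrableD_EFin.
  by apply: integrable_frob => i j; rewrite ord1; [exact: v1|exact: w1].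
exact: integrable_frob.
Qed.

Lemma H1dot_semi_inner : semi_inner L2pair H1dot.
Proof.
split=> [a u v w Lu Lv Lw|u v _ _|u _].
- rewrite /H1dot -RintegralZl//; last exact: L2pair_integrable.
  rewrite -RintegralD//.
  + by apply: eq_Rintegral => x _; rewrite !frobP; ring.
  + exact: (integrableZ_EFin a (L2pair_integrable Lu Lw)).
  + exact: L2pair_integrable.
- by apply: eq_Rintegral => x _; rewrite frobC (frobC (u.2 x)).
- by apply: Rintegral_ge0 => x _; rewrite addr_ge0// frob_ge0.
Qed.

Lemma normH1_seminorm : seminorm_on L2pair (normH1 D).
Proof. exact: (semi_inner_seminorm L2pair_subspace H1dot_semi_inner). Qed.

Lemma H1_E0_L2pair w : H1_E0 D w -> L2pair w.
Proof. by move=> [[]]. Qed.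

Lemma Ck_cst0 k : Ck k (fun _ : 'rV[R]_d => 0 : R).
Proof.
elim: k => [|k ih] /=; split => //; try exact: cst_continuous.
move=> j; split; first by move=> x; exact: derivable_cst.
rewrite (_ : partial _ _ = fun=> 0)//.
by apply/funext => x; rewrite /partial derive_cst.
Qed.

Lemma partialP j (a : R) (f g : 'rV[R]_d -> R) x :
  derivable f x (delta_mx ord0 j) -> derivable g x (delta_mx ord0 j) ->
  partial j (fun z => a * f z + g z) x = a * partial j f x + partial j g x.
Proof.
move=> df dg; rewrite /partial.
by rewrite (deriveD (derivableZ df) dg) (deriveZ a df).
Qed.

Lemma CkP k (a : R) (f g : 'rV[R]_d -> R) : Ck k f -> Ck k g ->
  Ck k (fun z => a * f z + g z).
Proof.
elim: k f g => [|k ih] f g /= [cf df] [cg dg]; split => //.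
- by move=> x; exact: (cvgD (cvgM (cvg_cst a) (cf x)) (cg x)).
- by move=> x; exact: (cvgD (cvgM (cvg_cst a) (cf x)) (cg x)).
- move=> j; have [dfj Cf] := df j; have [dgj Cg] := dg j; split.
    by move=> x; exact: (derivableD (derivableZ (k := a) (dfj x)) (dgj x)).
  rewrite (_ : partial _ _ = fun z => a * partial j f z + partial j g z).
    exact: ih.
  by apply/funext => x; rewrite partialP.
Qed.

Lemma smooth_derivable (f : 'rV[R]_d -> R) j x :
  smooth f -> derivable f x (delta_mx ord0 j).
Proof. by move=> /(_ 1%N) [_ /(_ j)[]]. Qed.

Lemma smooth_continuous (f : 'rV[R]_d -> R) : smooth f -> continuous f.
Proof. by move=> /(_ 0%N) []. Qed.

Lemma smooth_partial_continuous (f : 'rV[R]_d -> R) j :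
  smooth f -> continuous (partial j f).
Proof. by move=> /(_ 1%N) [_ /(_ j)[_ []]]. Qed.

(** Puts the approximants of a trace where [normH1] obeys the triangle inequality, without an
    integration by parts. *)
Lemma smooth_L2pair (phi : 'rV[R]_d -> 'rV[R]_d) :
  (forall i, smooth (fun x => phi x ord0 i)) -> L2pair (phi, jacobian_mx phi).
Proof.
move=> sphi; split=> [i|i j] /=.
  by apply: continuous_sqint; exact: smooth_continuous.
apply: continuous_sqint; rewrite (_ : (fun x => _) =
  partial j (fun z => phi z ord0 i)); last by apply/funext => x; rewrite mxE.
exact: smooth_partial_continuous.
Qed.

(** Intersecting with [L2pair] makes both integrands of the weak-gradient identity integrable, so
    that the integrals split. *)
Lemma weak_gradient_subspace :
  linear_subspace (L2pair `&` @weak_gradient R d D).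
Proof.
split.
  split; first exact: L2pair_subspace.1.
  move=> phi _ i j.
  under eq_Rintegral do rewrite mxE mul0r.
  under [in RHS]eq_Rintegral do rewrite mxE mul0r.
  by rewrite Rintegral_cst// mul0r oppr0.
move=> a v w [Lv gv] [Lw gw]; split; first exact: L2pair_subspace.2.
move=> phi tphi i j; have [sphi _] := tphi.
have Lphi : sqint mu phi by apply: continuous_sqint; exact: smooth_continuous.
have Ldphi : sqint mu (partial j phi).
  by apply: continuous_sqint; exact: smooth_partial_continuous.
have iv1 := sqint_mul (Lv.1 i) Ldphi; have iw1 := sqint_mul (Lw.1 i) Ldphi.
have iv2 := sqint_mul (Lv.2 i j) Lphi; have iw2 := sqint_mul (Lw.2 i j) Lphi.
under eq_Rintegral do rewrite !mxE mulrDl -mulrA.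
under [in RHS]eq_Rintegral do rewrite !mxE mulrDl -mulrA.
rewrite !RintegralD//; [|exact: (integrableZ_EFin a)..].
rewrite !RintegralZl// gv// gw//; ring.
Qed.

End H1_theory.

Lemma measurable_chart (R : realType) (d : nat) (a : 'rV[R]_d)
    (Q : 'M[R]_(d.-1, d)) : measurable_fun setT (chart a Q).
Proof.
apply: measurable_fun_rV => i.
rewrite (_ : _ \o _ =
    fun t => a ord0 i + \sum_j rV_coord j t * Q j i); last first.
  by apply/funext => t; rewrite /= /rV_coord /chart !mxE.
apply: measurable_funD => //; apply: measurable_sum => j.
by apply: measurable_funM => //; exact: measurable_coord.
Qed.

Lemma measurable_frontier (R : realType) (d : nat) (A : set 'rV[R]_d) :
  measurable (frontier A).
Proof.
apply: measurableD; last by apply: open_measurable_rV; exact: open_interior.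
rewrite -[closure A]setCK; apply: measurableC; apply: open_measurable_rV.
by apply: closed_openC; exact: closed_closure.
Qed.

(** * Linearity of the trace *)

Section trace_theory.
Context {R : realType} {d : nat} (D : domain R d).
Local Notation mu := (leb_on D).

Lemma jacobian_mxP (a : R) (f g : 'rV[R]_d -> 'rV[R]_d) :
  (forall i, smooth (fun x => f x ord0 i)) ->
  (forall i, smooth (fun x => g x ord0 i)) ->
  jacobian_mx (fun x => a *: f x + g x) =
  (fun x => a *: jacobian_mx f x + jacobian_mx g x).
Proof.
move=> sf sg; apply/funext => x; apply/matrixP => i j; rewrite !mxE.
rewrite -partialP; try exact: smooth_derivable.
by congr (partial j _ x); apply/funext => z; rewrite !mxE.
Qed.

Lemma is_trace0 : is_trace D 0 (fun=> 0).
Proof.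
split; first exact: measurable_cst.
exists (fun _ _ => 0); split.
- move=> n i k; rewrite (_ : (fun x => _) = fun=> 0); first exact: Ck_cst0.
  by apply/funext => x; rewrite mxE.
- rewrite (_ : (fun n => _) = cst 0); first exact: cvg_cst.
  apply/funext => n /=.
  have -> : (fun=> 0, jacobian_mx (fun=> 0)) = 0 :> H1rep R d.
    congr pair; apply/funext => x; apply/matrixP => i j; rewrite !mxE.
    by rewrite /partial derive_cst.
  rewrite subrr -(scale0r 0) (seminormZ (normH1_seminorm D)).
    by rewrite normr0 mul0r.
  exact: (L2pair_subspace D).1.
- move=> a Q _; rewrite (_ : (fun n => _) = cst 0%E); first exact: cvg_cst.
  apply/funext => n; apply: integral0_eq => t _.
  rewrite subr0 /frob big1// => i _; rewrite big1// => j _.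
  by rewrite mxE mul0r.
Qed.

Lemma is_traceP a v w g h : L2pair D v -> L2pair D w ->
  is_trace D v g -> is_trace D w h ->
  is_trace D (a *: v + w) (fun x => a *: g x + h x).
Proof.
move=> Lv Lw [mg [phi [sphi phiv phig]]] [mh [psi [spsi psiw psih]]].
have coordP (f1 f2 : 'rV[R]_d -> 'rV[R]_d) i :
    (fun x => (a *: f1 x + f2 x) ord0 i) =
    (fun x => a * f1 x ord0 i + f2 x ord0 i).
  by apply/funext => x; rewrite !mxE.
have mcoord (f : 'rV[R]_d -> 'rV[R]_d) i : measurable_fun setT f ->
    measurable_fun setT (fun x => f x ord0 i).
  by move=> mf; exact: (measurableT_comp (measurable_coord i) mf).
split.
  apply: measurable_fun_rV => i.
  have -> : rV_coord i \o (fun x => a *: g x + h x) =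
      (fun x => a * g x ord0 i + h x ord0 i) by exact: coordP.
  apply: measurable_funD; last exact: mcoord.
  by apply: measurable_funM => //; exact: mcoord.
exists (fun n x => a *: phi n x + psi n x); split.
- by move=> n i; rewrite coordP => k; apply: CkP; [exact: sphi|exact: spsi].
- have NS := normH1_seminorm D; have LS := L2pair_subspace D.
  apply: (@squeeze_cvgr _ _ _ _ (cst 0) (fun n =>
      `|a| * normH1 D (v - (phi n, jacobian_mx (phi n))) +
      normH1 D (w - (psi n, jacobian_mx (psi n))))).
  + near=> n; rewrite (seminorm_ge0 NS)/=.
    rewrite (_ : _ - _ = a *: (v - (phi n, jacobian_mx (phi n))) +
        (w - (psi n, jacobian_mx (psi n)))).
      apply: (seminormP LS NS); apply: (subspaceB LS) => //.
        exact: smooth_L2pair.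
      exact: smooth_L2pair.
    rewrite jacobian_mxP// scalerBr addrACA -opprD; congr (_ - _).
  + exact: cvg_cst.
  + have := cvgD (cvgM (cvg_cst `|a|) phiv) psiw.
    by rewrite mulr0 addr0; exact.
- move=> b Q QQ.
  have mS : measurable (chart b Q @^-1` frontier D).
    rewrite -[X in measurable X]setTI; apply: measurable_chart => //.
    exact: measurable_frontier.
  have mdiff (f : nat -> 'rV[R]_d -> 'rV[R]_d) (f' : 'rV[R]_d -> 'rV[R]_d) n i :
      (forall n i, smooth (fun x => f n x ord0 i)) -> measurable_fun setT f' ->
      measurable_fun setT
        (fun t => (f n (chart b Q t) - f' (chart b Q t)) ord0 i).
    move=> sf mf'.
    rewrite (_ : (fun t => _) = (fun x => f n x ord0 i - f' x ord0 i) \o chart b Q).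
      apply: measurableT_comp; last exact: measurable_chart.
      apply: measurable_funB; last exact: mcoord.
      by apply: continuous_measurable_rV; exact: smooth_continuous.
    by apply/funext => t; rewrite !mxE.
  have mfrob (f : nat -> 'rV[R]_d -> 'rV[R]_d) (f' : 'rV[R]_d -> 'rV[R]_d) n :
      (forall n i, smooth (fun x => f n x ord0 i)) -> measurable_fun setT f' ->
      measurable_fun (chart b Q @^-1` frontier D)
        (fun t => (frob (f n (chart b Q t) - f' (chart b Q t))
                       (f n (chart b Q t) - f' (chart b Q t)))%:E).
    move=> sf mf'; apply/measurable_EFinP; apply: measurable_funTS.
    by apply: measurable_frob => i j; rewrite ord1; exact: mdiff.
  (* The boundary integrals are extended reals and may be infinite for the first [n]; a pointwise
     bound on squares, with the constants of [frobP_sqr], replaces the triangle inequality of an L^2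
     norm. *)
  apply: (@squeeze_cvge _ _ _ _ (cst 0%E) _ (fun n =>
      (2 * a ^+ 2)%:E * \int[leb R d.-1]_(t in chart b Q @^-1` frontier D)
         (frob (phi n (chart b Q t) - g (chart b Q t))
               (phi n (chart b Q t) - g (chart b Q t)))%:E +
      2%:E * \int[leb R d.-1]_(t in chart b Q @^-1` frontier D)
         (frob (psi n (chart b Q t) - h (chart b Q t))
               (psi n (chart b Q t) - h (chart b Q t)))%:E)%E).
  + near=> n; apply/andP; split.
      by apply: integral_ge0 => t _; rewrite lee_fin frob_ge0.
    have a20 : (0 <= (2 * a ^+ 2)%:E)%E by rewrite lee_fin mulr_ge0// sqr_ge0.
    rewrite -!ge0_integralZl//; try exact: mfrob;
      try by move=> t _; rewrite lee_fin frob_ge0.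
    have mphi n' := mfrob phi g n' sphi mg.
    have mpsi n' := mfrob psi h n' spsi mh.
    rewrite -ge0_integralD//; last 4 first.
    * by move=> t _; rewrite mule_ge0// lee_fin ?frob_ge0// mulr_ge0// sqr_ge0.
    * exact: measurable_funeM.
    * by move=> t _; rewrite mule_ge0// lee_fin ?frob_ge0.
    * exact: measurable_funeM.
    have combE x : a *: phi n x + psi n x - (a *: g x + h x) =
        a *: (phi n x - g x) + (psi n x - h x).
      by rewrite scalerBr opprD addrACA.
    apply: ge0_le_integral => //.
    * by move=> t _; rewrite lee_fin frob_ge0.
    * apply: (mfrob (fun n x => a *: phi n x + psi n x) (fun x => a *: g x + h x)).
        move=> n' i; rewrite coordP => k.
        by apply: CkP; [exact: sphi|exact: spsi].
      apply: measurable_fun_rV => i.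
      have -> : rV_coord i \o (fun x => a *: g x + h x) =
          (fun x => a * g x ord0 i + h x ord0 i) by exact: coordP.
      apply: measurable_funD; last exact: mcoord.
      by apply: measurable_funM => //; exact: mcoord.
    * by apply: emeasurable_funD; exact: measurable_funeM.
    * by move=> t _; rewrite combE -!EFinM -EFinD lee_fin frobP_sqr.
  + exact: cvg_cst.
  + have := cvgeD _ (cvgeZl (y := (2 * a ^+ 2)%:E) _ (phig b Q QQ))
                    (cvgeZl (y := 2%:E) _ (psih b Q QQ)).
    by rewrite !mule0 adde0; apply.
Unshelve. all: by end_near. Qed.

End trace_theory.

(** * The forms on V *)

Section H1_E0_theory.
Context {R : realType} {d : nat} (D : domain R d).
Local Notation mu := (leb_on D).

Lemma H1_E0_subspace : linear_subspace (H1_E0 D).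
Proof.
have [G0 GP] := weak_gradient_subspace D; split.
  split; first by have [[L1 L2'] g0] := G0.
  exists (fun=> 0); first exact: is_trace0.
  by move=> a Q _; exact: nearW.
move=> a v w Hv Hw.
have Lv := H1_E0_L2pair Hv; have Lw := H1_E0_L2pair Hw.
have [[_ _ gv] [g tg g0]] := Hv; have [[_ _ gw] [h th h0]] := Hw.
have [[L1 L2'] gvw] := GP a v w (conj Lv gv) (conj Lw gw).
split => //; exists (fun x => a *: g x + h x); first exact: is_traceP.
move=> b Q QQ; apply: filterS2 (g0 b Q QQ) (h0 b Q QQ) => t gt ht Dt.
by rewrite gt// ht// scaler0 addr0.
Qed.

Lemma H1_E0_seminorm : seminorm_on (H1_E0 D) (normH1 D).
Proof.
have NS := normH1_seminorm D; split=> [x|a x Zx|x y Zx Zy].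
- exact: (seminorm_ge0 NS).
- by apply: (seminormZ NS); exact: H1_E0_L2pair.
- by apply: (seminormD NS); exact: H1_E0_L2pair.
Qed.

Lemma normL2_grad_coord w i j : L2pair D w ->
  normL2 D (fun x => w.2 x i j) <= normH1 D w.
Proof.
move=> Lw; rewrite ler_wsqrtr//; apply: le_Rintegral => //.
- exact: (sqint_mul (Lw.2 i j) (Lw.2 i j)).
- exact: L2pair_integrable.
- move=> x _; rewrite (le_trans (frob_coord _ i j))// lerDr.
  exact: frob_ge0.
Qed.

End H1_E0_theory.

Section V_theory.
Context {R : realType} {d : nat} (D : domain R d) (M : nat).
Local Notation mu := (leb_on D).
Local Notation V := (@V R d D M).
Local Notation W := (@W R d D M).
Implicit Types (u v w : 'rV[R]_M -> H1rep R d).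
Implicit Types (p q : 'rV[R]_M -> 'rV[R]_d -> R).

Lemma V_subspace : linear_subspace V.
Proof. exact: (bochnerL2_subspace M (H1_E0_subspace D) (H1_E0_seminorm D)). Qed.

Definition gradc (ij : 'I_d * 'I_d) u : 'rV[R]_M -> 'rV[R]_d -> R :=
  fun y x => (u y).2 x ij.1 ij.2.

Definition epsc (ij : 'I_d * 'I_d) u : 'rV[R]_M -> 'rV[R]_d -> R :=
  fun y x => eps ((u y).2 x) ij.1 ij.2.

Lemma gradcP ij (a : R) u v :
  gradc ij (a *: u + v) = a *: gradc ij u + gradc ij v.
Proof. by apply/funext => y; apply/funext => x; rewrite /gradc !mxE. Qed.

Lemma epscE ij u :
  epsc ij u = 2^-1 *: (gradc ij u + gradc (ij.2, ij.1) u).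
Proof. by apply/funext => y; apply/funext => x; rewrite /epsc !mxE. Qed.

Lemma epscP ij (a : R) u v : epsc ij (a *: u + v) = a *: epsc ij u + epsc ij v.
Proof.
rewrite !epscE !gradcP !scalerDr !scalerA (mulrC 2^-1 a).
by rewrite -!addrA; congr (_ + _); rewrite addrCA.
Qed.

Lemma gradc_W ij u : V u -> W (gradc ij u).
Proof.
have LS := sqint_subspace mu.
have NS : seminorm_on (L2 D) (normL2 D).
  exact: (semi_inner_seminorm LS (dot_semi_inner mu)).
have H := bochnerL2_map (P := fun (w : H1rep R d) x => w.2 x ij.1 ij.2)
  (u := u) (C := 1) (H1_E0_subspace D) (H1_E0_seminorm D) LS NS.
apply: H.
- by move=> a v w; apply/funext => x; rewrite !mxE.
- by move=> v /H1_E0_L2pair Lv; exact: Lv.2.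
- by move=> v /H1_E0_L2pair Lv; rewrite mul1r; exact: normL2_grad_coord.
Qed.

Lemma epsc_W ij u : V u -> W (epsc ij u).
Proof.
move=> Vu; rewrite epscE; apply: (subspaceZ (W_subspace D M)).
by apply: (subspaceD (W_subspace D M)); exact: gradc_W.
Qed.

Definition grad_prod u v : R := \sum_ij iprod D (gradc ij u) (gradc ij v).

Lemma grad_prod_semi_inner : semi_inner V grad_prod.
Proof.
apply: (semi_inner_sum (iprod_semi_inner D M) gradcP) => ij u.
exact: gradc_W.
Qed.

Lemma iprod_frob (F G : 'rV[R]_M -> 'rV[R]_d -> 'M[R]_d) :
  (forall ij, W (fun y x => F y x ij.1 ij.2)) ->
  (forall ij, W (fun y x => G y x ij.1 ij.2)) ->
  (pi_Gamma R M).-integrable setT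
    (EFin \o (fun y => \int[mu]_x frob (F y x) (G y x))) /\
  \int[pi_Gamma R M]_y \int[mu]_x frob (F y x) (G y x) =
  \sum_ij iprod D (fun y x => F y x ij.1 ij.2) (fun y x => G y x ij.1 ij.2).
Proof.
move=> WF WG.
have E y : \int[mu]_x frob (F y x) (G y x) =
    \sum_ij \int[mu]_x (F y x ij.1 ij.2 * G y x ij.1 ij.2).
  rewrite Rintegral_frob ?pair_bigA// => i j.
    by have [+ _ _] := WF (i, j); exact.
  by have [+ _ _] := WG (i, j); exact.
have iE ij := W_dot_integrable (WF ij) (WG ij).
split.
  rewrite (_ : EFin \o _ = fun y => (\sum_ij
      (\int[mu]_x (F y x ij.1 ij.2 * G y x ij.1 ij.2))%:E)%E).
    by apply: integrable_sum => // ij _; exact: iE.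
  by apply/funext => y /=; rewrite E sumEFin.
by under eq_Rintegral do rewrite E; rewrite Rintegral_sum.
Qed.

Lemma norm_gradE u : V u -> norm_grad D u = Num.sqrt (grad_prod u u).
Proof.
move=> Vu; rewrite /norm_grad; congr Num.sqrt.
by have [_ ->] := iprod_frob (fun ij => gradc_W ij Vu) (fun ij => gradc_W ij Vu).
Qed.

Definition eps_prod u v : R := \sum_ij iprod D (epsc ij u) (epsc ij v).

(** Korn's inequality concerns one field on [D]; it is used for each [y], as [u y] lies in [H1_E0 D]
    for every [y], and then integrated. *)
Lemma eps_prod_korn CK u : korn_constant D CK -> V u ->
  CK * grad_prod u u <= eps_prod u u.
Proof.
move=> kornD Vu; have [Hu _ _] := Vu.
have [ig Eg] := iprod_frob (fun ij => gradc_W ij Vu) (fun ij => gradc_W ij Vu).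
have [ie Ee] := iprod_frob (fun ij => epsc_W ij Vu) (fun ij => epsc_W ij Vu).
rewrite -[grad_prod u u]Eg -[eps_prod u u]Ee -RintegralZl//.
apply: le_Rintegral => //; first exact: (integrableZ_EFin CK ig).
by move=> y _; exact: kornD.
Qed.

Lemma frob_eps_le (G : 'M[R]_d) : frob (eps G) (eps G) <= frob G G.
Proof.
have -> : eps G = 2^-1 *: G + 2^-1 *: G^T by rewrite /eps scalerDr.
(* With both weights 1/2 the bound is half of [frob G G] plus half of [frob G^T G^T], and
   transposition preserves [frob]. *)
apply: (le_trans (frobP_sqr _ _ _)).
have -> : 2^-1 *: G^T = 2^-1 *: G^T + 0 by rewrite addr0.
have f0 A : frob (0 : 'M[R]_d) A = 0.
  by rewrite /frob big1// => i _; rewrite big1// => j _; rewrite mxE mul0r.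
rewrite frobP f0 addr0 frobC frobP f0 addr0.
have -> : frob G^T G^T = frob G G.
  rewrite /frob exchange_big; apply: eq_bigr => i _; apply: eq_bigr => j _.
  by rewrite !mxE.
lra.
Qed.

Lemma eps_prod_le u : V u -> eps_prod u u <= grad_prod u u.
Proof.
move=> Vu.
have [ig Eg] := iprod_frob (fun ij => gradc_W ij Vu) (fun ij => gradc_W ij Vu).
have [ie Ee] := iprod_frob (fun ij => epsc_W ij Vu) (fun ij => epsc_W ij Vu).
have Lg y ij : sqint mu (fun x => (u y).2 x ij.1 ij.2).
  by have [+ _ _] := gradc_W ij Vu; exact.
have Le y ij : sqint mu (fun x => eps ((u y).2 x) ij.1 ij.2).
  by have [+ _ _] := epsc_W ij Vu; exact.
rewrite -[grad_prod u u]Eg -[eps_prod u u]Ee.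
apply: le_Rintegral => // y _; apply: le_Rintegral => //.
- by apply: integrable_frob => i j; exact: (Le y (i, j)).
- by apply: integrable_frob => i j; exact: (Lg y (i, j)).
- by move=> x _; exact: frob_eps_le.
Qed.

Definition divc v : 'rV[R]_M -> 'rV[R]_d -> R := fun y x => \tr ((v y).2 x).

Lemma form_bE v p : form_b D v p = - iprod D p (divc v).
Proof. by []. Qed.

Lemma divcP (a : R) v w : divc (a *: v + w) = a *: divc v + divc w.
Proof.
by apply/funext => y; apply/funext => x; rewrite /divc /= mxtraceD mxtraceZ.
Qed.

Lemma divc_W v : V v -> W (divc v).
Proof.
move=> Vv; rewrite (_ : divc v = \sum_i gradc (i, i) v).
  elim/big_ind : _ => [|x y|i _]; first exact: (W_subspace D M).1.
    exact: (subspaceD (W_subspace D M)).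
  exact: gradc_W.
by apply/funext => y; apply/funext => x; rewrite !fct_sumE.
Qed.

Lemma form_bP (a : R) v w p : V v -> V w -> W p ->
  form_b D (a *: v + w) p = a * form_b D v p + form_b D w p.
Proof.
move=> /divc_W Wv /divc_W Ww Wp; rewrite !form_bE divcP.
have -> := semi_innerPr (W_subspace D M) (iprod_semi_inner D M) a Wv Ww Wp.
by rewrite opprD mulrN.
Qed.

Lemma form_b0 p : W p -> form_b D 0 p = 0.
Proof.
move=> Wp; have V0 := V_subspace.1; have := form_bP 1 V0 V0 Wp.
rewrite scale1r addr0 mul1r; lra.
Qed.

Lemma form_bZ (a : R) v p : V v -> W p ->
  form_b D (a *: v) p = a * form_b D v p.
Proof.
move=> Vv Wp; have := form_bP a Vv V_subspace.1 Wp.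
by rewrite form_b0// !addr0.
Qed.

Lemma form_bZr (a : R) v p : V v -> W p ->
  form_b D v (a *: p) = a * form_b D v p.
Proof.
move=> /divc_W Wv Wp; rewrite !form_bE.
have -> := semi_innerZ (W_subspace D M) (iprod_semi_inner D M) a Wp Wv.
by rewrite mulrN.
Qed.

(** * The strain form weighted by Young's modulus *)

Section weighted_strain.
Variables (e0 : 'rV[R]_d -> R) (e : 'I_M -> 'rV[R]_d -> R).
Hypotheses (e0oo : e0 \in Lfun mu +oo%E) (eoo : forall k, e k \in Lfun mu +oo%E).
Local Notation E := (young e0 e).
Variables Emin Emax : R.
Hypothesis Emin_gt0 : 0 < Emin.
Hypothesis Ebnd : {ae (mu \x pi_Gamma R M)%E,
  forall z, Emin <= E z.1 z.2 <= Emax}.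

(** Valid for every [y], even outside Gamma, with a bound that may depend on [y] and exceed [Emax]:
    [form_aE] splits the inner integral for each [y], not just almost every one. *)
Lemma young_ess_bounded y : exists K, ess_bounded mu (fun x => E x y) K.
Proof.
apply: Lfuny_ess_bounded.
rewrite (_ : (fun x => _) = e0 + \sum_k y ord0 k *: e k).
  have [L0 LP] := @Lfun_submod_closed _ _ _ mu +oo%E (leey _).
  have LD f g : f \in Lfun mu +oo%E -> g \in Lfun mu +oo%E ->
      f + g \in Lfun mu +oo%E.
    by move=> Lf Lg; rewrite -[f]scale1r; exact: LP.
  apply: (LD _ _ e0oo).
  apply: (big_ind (fun f => f \in Lfun mu +oo%E)); [exact: L0|exact: LD|].
  move=> k _.
  by rewrite -[_ *: _]addr0; apply: LP => //; exact: L0.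
apply/funext => x; rewrite /young; congr (_ + _); rewrite fct_sumE.
by apply: eq_bigr => k _; rewrite mulrC.
Qed.

Definition strain_prod u v : R := \sum_ij wform D e0 e (epsc ij u) (epsc ij v).

Lemma form_aE alpha u v : V u -> V v ->
  form_a D alpha E u v = alpha * strain_prod u v.
Proof.
move=> Vu Vv; congr (_ * _).
have Lu y ij : sqint mu (fun x => eps ((u y).2 x) ij.1 ij.2).
  by have [+ _ _] := epsc_W ij Vu; exact.
have Lv y ij : sqint mu (fun x => eps ((v y).2 x) ij.1 ij.2).
  by have [+ _ _] := epsc_W ij Vv; exact.
have inner y : \int[mu]_x (E x y * frob (eps ((u y).2 x)) (eps ((v y).2 x))) =
    \sum_ij \int[mu]_x (E x y * epsc ij u y x * epsc ij v y x).
  have [K EK] := young_ess_bounded y.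
  have frobZ a (A B : 'M[R]_d) : a * frob A B = frob (a *: A) B.
    rewrite /frob mulr_sumr; apply: eq_bigr => i _; rewrite mulr_sumr.
    by apply: eq_bigr => j _; rewrite mxE mulrA.
  under eq_Rintegral do rewrite frobZ.
  rewrite Rintegral_frob ?pair_bigA.
  - apply: eq_bigr => ij _; apply: eq_Rintegral => x _.
    by rewrite /epsc mxE.
  - move=> i j; rewrite (_ : (fun x => _) =
        (fun x => E x y) \* (fun x => eps ((u y).2 x) i j)).
      by have [] := ess_bounded_mul EK (Lu y (i, j)).
    by apply/funext => x; rewrite mxE.
  - by move=> i j; exact: (Lv y (i, j)).
under eq_Rintegral do rewrite inner; rewrite Rintegral_sum// => ij.
exact: (wform_integrable e0oo eoo Emin_gt0 Ebnd (epsc_W ij Vu) (epsc_W ij Vv)).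
Qed.

Lemma strain_prod_semi_inner : semi_inner V strain_prod.
Proof.
have WI := wform_semi_inner e0oo eoo Emin_gt0 Ebnd.
by apply: (semi_inner_sum WI epscP) => ij u; exact: epsc_W.
Qed.

Lemma strain_prod_bounds u : V u ->
  Emin * eps_prod u u <= strain_prod u u <= Emax * eps_prod u u.
Proof.
move=> Vu; rewrite !mulr_sumr; apply/andP; split; apply: ler_sum => ij _;
  by have /andP[] := wform_bounds e0oo eoo Emin_gt0 Ebnd (epsc_W ij Vu).
Qed.

End weighted_strain.

End V_theory.

(** * Coercivity *)

(** The supremum need not be attained; halving [CD] leaves room for an actual maximiser up to a
    factor, which is then rescaled. *)
Lemma infsup_witness (R : realType) (d M : nat) (D : domain R d) (CD : R)
    (p : 'rV[R]_M -> 'rV[R]_d -> R) :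
  0 < CD -> infsup_constant D M CD -> W D p ->
  exists w, [/\ V D w, grad_prod D w w <= iprod D p p &
    CD / 2 * iprod D p p <= form_b D w p].
Proof.
move=> CD0 infsup Wp.
have PI := iprod_semi_inner D M; have GI := grad_prod_semi_inner D M.
have VS := V_subspace D M; have V0 := VS.1.
have p0 := semi_inner_ge0 PI Wp.
(* If |p| = 0 then half the bound is not strictly below the supremum bound, and w = 0 serves. *)
have [pp0|ppN0] := eqVneq (iprod D p p) 0.
  exists 0; split => //; last by rewrite form_b0// pp0 mulr0.
  by have -> : grad_prod D 0 0 = 0 := semi_inner0 VS GI V0.
have pgt0 : 0 < iprod D p p by rewrite lt_def ppN0.
have Np0 : 0 < normW D p by rewrite (normW_iprod Wp) sqrtr_gt0.
have lt_sup : ((CD / 2 * normW D p)%:E < (CD * normW D p)%:E)%E.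
  by rewrite lte_fin ltr_pM2r//; lra.
have /ereal_sup_gt[_ [v [Vv _] <-]] := lt_le_trans lt_sup (infsup p Wp).
rewrite lte_fin => bv.
(* The supremum excludes only [normV v = 0]. If the gradient norm were 0, the quotient would be 0 by
   the convention on division, against the strict lower bound. *)
have Nv0 : 0 < norm_grad D v.
  rewrite lt_def sqrtr_ge0 andbT; apply/eqP => Nv0.
  by move: bv; rewrite Nv0 invr0 mulr0 ltNge mulr_ge0 ?ltW// divr_gt0.
have gN : grad_prod D v v = norm_grad D v ^+ 2.
  by rewrite norm_gradE// sqr_sqrtr// (semi_inner_ge0 GI).
have pN : iprod D p p = normW D p ^+ 2 by rewrite (normW_iprod Wp) sqr_sqrtr.
(* Rescaling by [r] makes the gradient norm equal to |p|. *)
set r := normW D p / norm_grad D v.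
have Vrv : V D (r *: v) := subspaceZ VS r Vv.
exists (r *: v); split => //.
  have -> := semi_innerZZ VS GI r Vv; rewrite gN pN /r.
  by rewrite expr_div_n divfK ?expf_neq0// gt_eqF.
rewrite form_bZ// pN expr2 mulrA.
have -> : r * form_b D v p = form_b D v p / norm_grad D v * normW D p.
  by rewrite /r; ring.
by rewrite ler_wpM2r// ltW.
Qed.

(** Squaring reduces this to (t a + b / t)^2 >= 4 a b. The weight [t] decides how a cross term is
    shared between the two squares. *)
Lemma normr_le_amgm (R : realType) (x a b K t : R) : 0 <= K -> 0 <= a -> 0 <= b ->
  0 < t -> x ^+ 2 <= K ^+ 2 * (a * b) -> `|x| <= K * (t * a + b / t) / 2.
Proof.
move=> K0 a0 b0 t0 xab.
have t_neq0 : t != 0 by rewrite gt_eqF.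
rewrite -(@ler_pXn2r _ 2) ?nnegrE//; last first.
  by rewrite !mulr_ge0// addr_ge0// mulr_ge0// ?invr_ge0// ltW.
rewrite real_normK ?num_real// (le_trans xab)//.
rewrite !exprMn -mulrA ler_wpM2l ?sqr_ge0//.
have := sqr_ge0 (t * a - b / t).
have tt : t * a * (b / t) = a * b by field.
rewrite sqrrB sqrrD tt; lra.
Qed.

(** [U2], [W2], [P2], [T2] stand for the squared norms of grad u, grad w, p, p~, the letters [A] and
    [d] for the weighted forms, and [gam] for 1 / (alpha beta). Each cross term takes at most half
    of the two squares that absorb it. *)
Lemma coercivity_algebra (R : realType) (Emin Emax CK CD alpha gam : R)
    (U2 P2 T2 Auu Auw bwp dtt dtp W2 k1 : R) :
  0 < Emin -> 0 < Emax -> 0 < CK -> 0 < CD -> 0 < alpha -> 0 < gam ->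
  0 <= U2 -> 0 <= P2 -> 0 <= T2 -> 0 <= W2 ->  W2 <= P2 ->
  Emin * CK * U2 <= Auu -> Auw ^+ 2 <= Emax ^+ 2 * (U2 * W2) ->
  CD / 2 * P2 <= bwp -> Emin * T2 <= dtt -> dtp ^+ 2 <= Emax ^+ 2 * (T2 * P2) ->
  k1 = CK * CD / (2 * Emax ^+ 2) ->
  Emin * (CK / 2 * (alpha * U2) + k1 * CD / 4 * (alpha^-1 * P2)
   + gam * (T2 / 2 + P2 / (2 * Emax ^+ 2))) <=
  alpha * Auu + (Emin * k1) * Auw + (Emin * k1 / alpha) * bwp
  + gam * (Emin / Emax ^+ 2 * P2 + dtt - Emin / Emax ^+ 2 * dtp).
Proof.
move=> Emin0 Emax0 CK0 CD0 al0 gam0 U0 P0 T0 W0 WP Au Aw bw dt dp k1E.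
have k10 : 0 < k1 by rewrite k1E divr_gt0 ?mulr_gt0// exprn_gt0.
have Emax_neq0 : Emax != 0 by rewrite gt_eqF.
have CD_neq0 : CD != 0 by rewrite gt_eqF.
have al_neq0 : alpha != 0 by rewrite gt_eqF.
(* With this weight the share of [P2] in the cross term is half the gain from [bwp]; the value of
   [k1] is the one for which the share of [U2] is half the Korn term. *)
pose t := 2 * Emax / CD * alpha.
have t0 : 0 < t by rewrite !mulr_gt0// invr_gt0.
have Aw' : Auw ^+ 2 <= Emax ^+ 2 * (U2 * P2).
  by rewrite (le_trans Aw)// ler_wpM2l ?sqr_ge0// ler_wpM2l.
have := normr_le_amgm (ltW Emax0) U0 P0 t0 Aw'; rewrite ler_norml => /andP[HA _].
(* With weight [Emax] and the factor [Emin / Emax ^+ 2] the cross term takes half of [Emin * T2] and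
   half of [Emin / Emax ^+ 2 * P2]. *)
have := normr_le_amgm (ltW Emax0) T0 P0 Emax0 dp; rewrite ler_norml => /andP[_ HD].
have HA' : - (Emin * (CK / 2 * (alpha * U2) + k1 * CD / 4 * (alpha^-1 * P2)))
    <= Emin * k1 * Auw.
  have -> : - (Emin * (CK / 2 * (alpha * U2) + k1 * CD / 4 * (alpha^-1 * P2))) =
      Emin * k1 * - (Emax * (t * U2 + P2 / t) / 2).
    by rewrite k1E /t; field; rewrite ?al_neq0 ?Emax_neq0 ?CD_neq0.
  by rewrite ler_wpM2l// mulr_ge0// ltW.
have HD' : Emin / Emax ^+ 2 * dtp <= Emin * (T2 / 2 + P2 / (2 * Emax ^+ 2)).
  have -> : Emin * (T2 / 2 + P2 / (2 * Emax ^+ 2)) =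
      Emin / Emax ^+ 2 * (Emax * (Emax * T2 + P2 / Emax) / 2) by field.
  by rewrite ler_wpM2l// divr_ge0// ?sqr_ge0// ltW.
have HU : Emin * CK * (alpha * U2) <= alpha * Auu.
  by rewrite mulrCA ler_wpM2l// ltW.
have HB : Emin * (k1 * CD / 2 * (alpha^-1 * P2)) <= Emin * k1 / alpha * bwp.
  have -> : Emin * (k1 * CD / 2 * (alpha^-1 * P2)) =
    Emin * k1 / alpha * (CD / 2 * P2) by field.
  by rewrite ler_wpM2l// divr_ge0// ?mulr_ge0// ltW.
have HG : gam * (Emin * (T2 / 2 + P2 / (2 * Emax ^+ 2))) <=
    gam * (Emin / Emax ^+ 2 * P2 + dtt - Emin / Emax ^+ 2 * dtp).
  rewrite ler_wpM2l ?(ltW gam0)//.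
  have -> : Emin / Emax ^+ 2 * P2 = 2 * (Emin * (P2 / (2 * Emax ^+ 2))) by field.
  move: HD'; set q := P2 / _; set r := _ * dtp; lra.
move: HA' HB HG HU; set q := P2 / _; set G := gam * (_ - _); set A := Emin * k1 * _.
set B := _ * bwp; set x := alpha * U2; set y := alpha^-1 * P2; lra.
Qed.

Lemma triple_ge0 (R : realType) (alpha gam U2 P2 T2 : R) :
  0 < alpha -> 0 < gam -> 0 <= U2 -> 0 <= P2 -> 0 <= T2 ->
  0 <= alpha * U2 + (alpha^-1 + gam) * P2 + gam * T2.
Proof.
move=> al0 gam0 U0 P0 T0.
by rewrite !addr_ge0 ?mulr_ge0 ?addr_ge0 ?invr_ge0 ?(ltW al0) ?(ltW gam0).
Qed.

(** [C1] lies below the four coefficients left by [coercivity_algebra], which multiply [alpha * U2],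
    [alpha^-1 * P2], [gam * T2] and [gam * P2]. The uncancelled [/ alpha * alpha] has the shape
    produced by [form_B_test]. *)
Lemma coercivity_bound (R : realType) (Emin Emax CK CD alpha gam : R)
    (U2 P2 T2 Auu Auw bwp dtt dtp W2 k1 C1 : R) :
  0 < Emin -> 0 < Emax -> 0 < CK -> 0 < CD -> 0 < alpha -> 0 < gam ->
  0 <= U2 -> 0 <= P2 -> 0 <= T2 -> 0 <= W2 ->  W2 <= P2 ->
  Emin * CK * U2 <= Auu -> Auw ^+ 2 <= Emax ^+ 2 * (U2 * W2) ->
  CD / 2 * P2 <= bwp -> Emin * T2 <= dtt -> dtp ^+ 2 <= Emax ^+ 2 * (T2 * P2) ->
  k1 = CK * CD / (2 * Emax ^+ 2) ->
  C1 <= CK / 2 -> C1 <= k1 * CD / 4 -> C1 <= 2^-1 ->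
  C1 <= (2 * Emax ^+ 2)^-1 ->
  Emin * C1 * (alpha * U2 + (alpha^-1 + gam) * P2 + gam * T2) <=
  alpha * Auu + (Emin * k1 / alpha) * alpha * Auw + (Emin * k1 / alpha) * bwp
  + gam * (Emin / Emax ^+ 2 * P2 + dtt - Emin / Emax ^+ 2 * dtp).
Proof.
move=> Emin0 Emax0 CK0 CD0 al0 gam0 U0 P0 T0 W0 WP Au Aw bw dt dp k1E.
move=> C1a C1b C1c C1d.
rewrite divfK ?gt_eqF//.
apply: le_trans
  (coercivity_algebra Emin0 Emax0 CK0 CD0 al0 gam0 U0 P0 T0 W0 WP Au Aw bw dt dp k1E).
rewrite -mulrA ler_pM2l//.
have a0 : 0 <= alpha * U2 by rewrite mulr_ge0// ltW.
have b0 : 0 <= alpha^-1 * P2 by rewrite mulr_ge0// invr_ge0 ltW.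
have c0 : 0 <= gam * P2 by rewrite mulr_ge0// ltW.
have f0 : 0 <= gam * T2 by rewrite mulr_ge0// ltW.
have Ha := ler_wpM2r a0 C1a; have Hb := ler_wpM2r b0 C1b.
have Hc := ler_wpM2r f0 C1c; have Hd := ler_wpM2r c0 C1d.
have -> : C1 * (alpha * U2 + (alpha^-1 + gam) * P2 + gam * T2) =
  C1 * (alpha * U2) + C1 * (alpha^-1 * P2) + (C1 * (gam * T2) + C1 * (gam * P2)).
  by ring.
have -> : gam * (T2 / 2 + P2 / (2 * Emax ^+ 2)) =
  2^-1 * (gam * T2) + (2 * Emax ^+ 2)^-1 * (gam * P2) by ring.
by rewrite !lerD.
Qed.

(* If [Emax < Emin], the bounds on [E] force the measure of [D \x Gamma], hence
   all the norms, to vanish. *)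
Lemma coercivity_degenerate (R : realType) (Emin Emax CK alpha gam : R)
    (U2 S2 P2 T2 Auu Auw bwp dpp dtt dtp C1 : R) :
  0 < Emin -> Emax < Emin -> 0 < CK -> 0 < alpha -> 0 < gam ->
  0 <= U2 -> 0 <= P2 -> 0 <= T2 -> CK * U2 <= S2 ->
  Emin * S2 <= Auu <= Emax * S2 -> Emin * P2 <= dpp <= Emax * P2 ->
  Emin * T2 <= dtt <= Emax * T2 ->
  Emin * C1 * (alpha * U2 + (alpha^-1 + gam) * P2 + gam * T2) <=
  alpha * Auu + 0 * alpha * Auw + 0 * bwp + gam * (0 * P2 + dtt - 0 * dtp).
Proof.
move=> Emin0 EE CK0 al0 gam0 U0 P0 T0 US HA HP HT.
have eq0 x y : 0 <= x -> Emin * x <= y <= Emax * x -> x = 0.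
  move=> x0 /andP[mxy yx]; apply/eqP; rewrite eq_le x0 andbT.
  have : (Emin - Emax) * x <= 0 by rewrite mulrBl; lra.
  by rewrite pmulr_rle0// subr_gt0.
have S0 : 0 <= S2 by rewrite (le_trans _ US)// mulr_ge0// ltW.
have SE := eq0 _ _ S0 HA; have PE := eq0 _ _ P0 HP; have TE := eq0 _ _ T0 HT.
have UE : U2 = 0.
  by apply/eqP; rewrite eq_le U0 andbT; move: US; rewrite SE pmulr_rle0.
move: HA HT; rewrite SE TE UE PE !mulr0 => /andP[A0 _] /andP[d0 _].
by rewrite !mul0r !addr0 add0r subr0 mulr0 addr_ge0// mulr_ge0// ltW.
Qed.

Lemma triple_normE (R : realType) (d M : nat) (D : domain R d) (alpha beta : R)
    (u : 'rV[R]_M -> H1rep R d) (p pt : 'rV[R]_M -> 'rV[R]_d -> R) :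
  V D u -> W D p -> W D pt ->
  triple_norm D alpha beta u p pt =
  Num.sqrt (alpha * grad_prod D u u
    + (alpha^-1 + (alpha * beta)^-1) * iprod D p p
    + (alpha * beta)^-1 * iprod D pt pt).
Proof.
move=> Vu Wp Wpt; have PI := iprod_semi_inner D M.
rewrite /triple_norm; congr Num.sqrt; congr (_ + _ + _); congr (_ * _).
- rewrite (norm_gradE Vu) sqr_sqrtr//.
  exact: (semi_inner_ge0 (grad_prod_semi_inner D M) Vu).
- by rewrite (normW_iprod Wp) sqr_sqrtr// (semi_inner_ge0 PI Wp).
- by rewrite (normW_iprod Wpt) sqr_sqrtr// (semi_inner_ge0 PI Wpt).
Qed.

Lemma triple_norm_sqr (R : realType) (d M : nat) (D : domain R d)
    (alpha beta : R)
    (u : 'rV[R]_M -> H1rep R d) (p pt : 'rV[R]_M -> 'rV[R]_d -> R) :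
  0 < alpha -> 0 < beta -> V D u -> W D p -> W D pt ->
  triple_norm D alpha beta u p pt ^+ 2 =
  alpha * grad_prod D u u
    + (alpha^-1 + (alpha * beta)^-1) * iprod D p p
    + (alpha * beta)^-1 * iprod D pt pt.
Proof.
move=> al0 be0 Vu Wp Wpt; have -> := triple_normE alpha beta Vu Wp Wpt.
have g0 : 0 < (alpha * beta)^-1 by rewrite invr_gt0 mulr_gt0.
apply: sqr_sqrtr; apply: triple_ge0 al0 g0 _ _ _.
- exact: (semi_inner_ge0 (grad_prod_semi_inner D M) Vu).
- exact: (semi_inner_ge0 (iprod_semi_inner D M) Wp).
- exact: (semi_inner_ge0 (iprod_semi_inner D M) Wpt).
Qed.

(** * The test triple: value of the form and size of the norm *)

Section test_functions.
Context {R : realType} {d : nat} (D : domain R d) (M : nat).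
Local Notation mu := (leb_on D).
Variables (e0 : 'rV[R]_d -> R) (e : 'I_M -> 'rV[R]_d -> R).
Hypotheses (e0oo : e0 \in Lfun mu +oo%E) (eoo : forall k, e k \in Lfun mu +oo%E).
Local Notation E := (young e0 e).
Variables Emin Emax : R.
Hypothesis Emin_gt0 : 0 < Emin.
Hypothesis Ebnd : {ae (mu \x pi_Gamma R M)%E,
  forall z, Emin <= E z.1 z.2 <= Emax}.
Variables (u w : 'rV[R]_M -> H1rep R d) (p pt : 'rV[R]_M -> 'rV[R]_d -> R).
Hypotheses (Vu : V D u) (Vw : V D w) (Wp : W D p) (Wpt : W D pt).

Let VS := V_subspace D M.
Let WS := W_subspace D M.

(** The test triple is written with [a *: x + y] so that the linearity lemmas rewrite it directly; s
    and t stay free, to cover also the degenerate choice s = t = 0. *)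
Lemma form_B_test (alpha beta s t : R) :
  form_B D alpha beta E u p pt (s *: w + u) (-1 *: p) (- t *: p + pt) =
  alpha * strain_prod D e0 e u u + s * alpha * strain_prod D e0 e u w
  + s * form_b D w p
  + (alpha * beta)^-1 * (t * iprod D p p + wform D e0 e pt pt
                         - t * wform D e0 e pt p).
Proof.
have PI := iprod_semi_inner D M.
have SI := strain_prod_semi_inner e0oo eoo Emin_gt0 Ebnd.
have WI := wform_semi_inner e0oo eoo Emin_gt0 Ebnd.
have Vv : V D (s *: w + u) by exact: VS.2.
rewrite /form_B (form_aE e0oo eoo Emin_gt0 Ebnd alpha Vu Vv).
have -> := semi_innerPr VS SI s Vw Vu Vu.
have -> := form_bP s Vw Vu Wp; have -> := form_bZr (-1) Vu Wp.
have -> : form_c D alpha beta pt (-1 *: p) =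
    (alpha * beta)^-1 * - iprod D pt p.
  rewrite /form_c -/(iprod D pt (-1 *: p)) -[_ *: _]addr0.
  have -> := semi_innerPr WS PI (-1) Wp WS.1 Wpt.
  by rewrite (semi_innerC PI Wpt WS.1) (semi_inner0 WS PI Wpt) mulN1r addr0.
have -> : form_c D alpha beta p (- t *: p + pt) =
    (alpha * beta)^-1 * (- t * iprod D p p + iprod D pt p).
  rewrite /form_c -/(iprod D p (- t *: p + pt)).
  have -> := semi_innerPr WS PI (- t) Wp Wpt Wp.
  by rewrite (semi_innerC PI Wp Wpt).
have -> : form_d D alpha beta E pt (- t *: p + pt) =
    (alpha * beta)^-1 * (- t * wform D e0 e pt p + wform D e0 e pt pt).
  rewrite /form_d -/(wform D e0 e pt (- t *: p + pt)).
  by have -> := semi_innerPr WS WI (- t) Wp Wpt Wpt.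
generalize (strain_prod D e0 e u u) (strain_prod D e0 e u w) (form_b D u p).
generalize (form_b D w p) (iprod D pt p) (iprod D p p) (wform D e0 e pt p).
generalize (wform D e0 e pt pt) => *; ring.
Qed.

Lemma triple_norm_test (alpha beta s t : R) : 0 < alpha -> 0 < beta ->
  grad_prod D w w <= iprod D p p ->
  triple_norm D alpha beta (s *: w + u) (-1 *: p) (- t *: p + pt) <=
  (2 + 2 * (alpha * s) ^+ 2 + 2 * t ^+ 2) * triple_norm D alpha beta u p pt.
Proof.
move=> al0 be0 wp.
have PI := iprod_semi_inner D M; have GI := grad_prod_semi_inner D M.
have al_neq0 : alpha != 0 by rewrite gt_eqF.
have Vv : V D (s *: w + u) := VS.2 s _ _ Vw Vu.
have Wq : W D (-1 *: p) := subspaceZ WS (-1) Wp.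
have Wqt : W D (- t *: p + pt) := WS.2 (- t) _ _ Wp Wpt.
have -> := triple_normE alpha beta Vv Wq Wqt.
have -> := triple_normE alpha beta Vu Wp Wpt.
have Hv : grad_prod D (s *: w + u) (s *: w + u) <=
    2 * s ^+ 2 * grad_prod D w w + 2 * grad_prod D u u.
  exact: (semi_innerPP_le VS GI).
have Hqt : iprod D (- t *: p + pt) (- t *: p + pt) <=
    2 * (- t) ^+ 2 * iprod D p p + 2 * iprod D pt pt.
  exact: (semi_innerPP_le WS PI).
have -> := semi_innerZZ WS PI (-1) Wp.
rewrite sqrrN in Hqt; rewrite sqrrN expr1n mul1r.
have U0 := semi_inner_ge0 GI Vu; have P0 := semi_inner_ge0 PI Wp.
have T0 := semi_inner_ge0 PI Wpt.
move: Hv Hqt wp U0 P0 T0.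
generalize (grad_prod D (s *: w + u) (s *: w + u)) => G.
generalize (iprod D (- t *: p + pt) (- t *: p + pt)) => Q.
generalize (grad_prod D w w) (grad_prod D u u) (iprod D p p) (iprod D pt pt).
move=> W2 U2 P2 T2 Hv Hqt wp U0 P0 T0.
set g := (alpha * beta)^-1.
have g0 : 0 < g by rewrite invr_gt0 mulr_gt0.
have a0 : 0 <= alpha * U2 by rewrite mulr_ge0// ltW.
have b0 : 0 <= alpha^-1 * P2 by rewrite mulr_ge0// invr_ge0 ltW.
have c0 : 0 <= g * P2 by rewrite mulr_ge0// ltW.
have d0 : 0 <= g * T2 by rewrite mulr_ge0// ltW.
set K := 2 + _ + _.
have K1 : 1 <= K.
  have := sqr_ge0 (alpha * s); have := sqr_ge0 t; rewrite /K; lra.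
have K0 : 0 <= K by rewrite (le_trans _ K1).
have -> z : K * Num.sqrt z = Num.sqrt (K ^+ 2 * z).
  by rewrite sqrtrM ?sqr_ge0// sqrtr_sqr ger0_norm.
rewrite ler_wsqrtr//.
set N := alpha * U2 + _ + _.
have N0 : 0 <= N.
  by rewrite /N mulrDl !addr_ge0.
(* The squares are bounded with the factor [K]; as [1 <= K], this is below [K ^+ 2], which keeps a
   square root out of the constant. *)
apply: (@le_trans _ _ (K * N)); last first.
  by rewrite ler_wpM2r// expr2 ler_peMr.
(* Here |grad w| <= |p| turns the contribution of w into a multiple of [alpha^-1 * P2], with a
   factor that involves s only through [alpha * s]. *)
have HG : alpha * G <= 2 * (alpha * s) ^+ 2 * (alpha^-1 * P2) + 2 * (alpha * U2).
  have -> : 2 * (alpha * s) ^+ 2 * (alpha^-1 * P2) + 2 * (alpha * U2) =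
    alpha * (2 * s ^+ 2 * P2 + 2 * U2) by field.
  rewrite ler_wpM2l ?(ltW al0)// (le_trans Hv)// lerD2r ler_wpM2l//.
  by rewrite mulr_ge0// sqr_ge0.
have HQ : g * Q <= 2 * t ^+ 2 * (g * P2) + 2 * (g * T2).
  have -> : 2 * t ^+ 2 * (g * P2) + 2 * (g * T2) =
    g * (2 * t ^+ 2 * P2 + 2 * T2) by ring.
  by rewrite ler_wpM2l ?(ltW g0).
rewrite /K /N mulrDl; move: HG HQ a0 b0 c0 d0.
move: (alpha * G) (g * Q) (alpha * U2) (alpha^-1 * P2) (g * P2) (g * T2).
move=> G' Q' a b c e' HG HQ a0 b0 c0 d0.
have := mulr_ge0 (sqr_ge0 (alpha * s)) a0.
have := mulr_ge0 (sqr_ge0 (alpha * s)) c0.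
have := mulr_ge0 (sqr_ge0 (alpha * s)) d0.
have := mulr_ge0 (sqr_ge0 t) a0; have := mulr_ge0 (sqr_ge0 t) b0.
have := mulr_ge0 (sqr_ge0 t) d0.
move: HG HQ; move: ((alpha * s) ^+ 2) (t ^+ 2) => x y; nra.
Qed.

End test_functions.

Theorem lemma2p3 (R : realType) (Emax CK CD : R) :
  0 < Emax -> 0 < CK <= 1 -> 0 < CD ->
  exists C1 C2 : R, [/\ 0 < C1, 0 < C2 &
    forall (d M : nat) (D : domain R d) (nu Emin e0min e0max : R)
      (e0 : 'rV[R]_d -> R) (e : 'I_M -> 'rV[R]_d -> R),
    let alpha := 1 / (1 + nu) in
    let beta := nu / (1 - 2 * nu) in
    let E := young e0 e in
    d = 2%N \/ d = 3%N ->
    0 < nu < 1 / 2 ->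
    korn_constant D CK ->
    infsup_constant D M CD ->
    e0 \in Lfun (leb_on D) +oo%E ->
    (forall k, e k \in Lfun (leb_on D) +oo%E) ->
    (fun z => E z.1 z.2) \in Lfun (leb_on D \x pi_Gamma R M)%E +oo%E ->
    0 < Emin ->
    {ae (leb_on D \x pi_Gamma R M)%E,
      forall z, Emin <= E z.1 z.2 <= Emax} ->
    0 < e0min ->
    {ae leb_on D, forall x, e0min <= e0 x <= e0max} ->
    ((1 / e0min)%R%:E * \sum_(k < M) 'N[leb_on D]_+oo[EFin \o e k] < 1)%E ->
    forall u p pt, V D u -> W D p -> W D pt ->
    exists v q qt,
      [/\ [/\ V D v, W D q & W D qt],
          triple_norm D alpha beta v q qt
            <= C2 * triple_norm D alpha beta u p pt
        & form_B D alpha beta E u p pt v q qt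
            >= Emin * C1 * triple_norm D alpha beta u p pt ^+ 2]].
Proof.
move=> Emax0 /andP[CK0 CK1] CD0.
pose k1 := CK * CD / (2 * Emax ^+ 2).
have k10 : 0 < k1 by rewrite divr_gt0 ?mulr_gt0// exprn_gt0.
(* The four coefficients required by [coercivity_bound]. *)
pose C1 := Num.min (Num.min (CK / 2) (k1 * CD / 4))
                   (Num.min 2^-1 (2 * Emax ^+ 2)^-1).
(* [C2] is the factor of [triple_norm_test] at the largest admissible values [alpha * s = Emax * k1]
   and [t = Emax^-1], which are free of [Emin]. *)
exists C1, (2 + 2 * (Emax * k1) ^+ 2 + 2 * (Emax^-1) ^+ 2); split.
- have e2 : 0 < 2 * Emax ^+ 2 by rewrite mulr_gt0// exprn_gt0.
  rewrite /C1 !lt_min (divr_gt0 CK0)// (divr_gt0 (mulr_gt0 k10 CD0))//.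
  by rewrite !invr_gt0 e2 ltr0n.
- by have := sqr_ge0 (Emax * k1); have := sqr_ge0 Emax^-1; lra.
move=> d M D nu Emin e0min e0max e0 e alpha beta E _ /andP[nu0 nu1] korn infsup.
move=> e0oo eoo _ Emin0 Ebnd _ _ _ u p pt Vu Wp Wpt.
have al0 : 0 < alpha by rewrite divr_gt0// addr_gt0.
have be0 : 0 < beta by rewrite divr_gt0// subr_gt0; lra.
have g0 : 0 < (alpha * beta)^-1 by rewrite invr_gt0 mulr_gt0.
have PI := iprod_semi_inner D M; have GI := grad_prod_semi_inner D M.
have SI := strain_prod_semi_inner e0oo eoo Emin0 Ebnd.
have WI := wform_semi_inner e0oo eoo Emin0 Ebnd.
have VS := V_subspace D M; have WS := W_subspace D M.
have U0 := semi_inner_ge0 GI Vu; have P0 := semi_inner_ge0 PI Wp.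
have T0 := semi_inner_ge0 PI Wpt.
have Abnd v (Vv : V D v) := strain_prod_bounds e0oo eoo Emin0 Ebnd Vv.
have dbnd q (Wq : W D q) := wform_bounds e0oo eoo Emin0 Ebnd Wq.
have kornu := eps_prod_korn korn Vu.
suff [w [s [t [Vw wp [s0 t0 sk tk] HB]]]] : exists w s t,
    [/\ V D w, grad_prod D w w <= iprod D p p,
      [/\ 0 <= alpha * s, 0 <= t, alpha * s <= Emax * k1 & t <= Emax^-1]
    & Emin * C1 * (alpha * grad_prod D u u
        + (alpha^-1 + (alpha * beta)^-1) * iprod D p p
        + (alpha * beta)^-1 * iprod D pt pt) <=
      alpha * strain_prod D e0 e u u + s * alpha * strain_prod D e0 e u w
      + s * form_b D w p
      + (alpha * beta)^-1 * (t * iprod D p p + wform D e0 e pt pt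
                             - t * wform D e0 e pt p)].
  exists (s *: w + u), (-1 *: p), (- t *: p + pt); split.
  - split; [exact: (VS.2 s _ _ Vw Vu)|exact: (subspaceZ WS (-1) Wp)|].
    exact: (WS.2 (- t) _ _ Wp Wpt).
  - apply: (le_trans (triple_norm_test Vu Vw Wp Wpt s t al0 be0 wp)).
    apply: ler_wpM2r; first exact: sqrtr_ge0.
    apply: lerD; first apply: lerD => //.
      by rewrite ler_pM2l// lerXn2r// nnegrE (le_trans s0).
    by rewrite ler_pM2l// lerXn2r// nnegrE (le_trans t0).
  - have -> := form_B_test e0oo eoo Emin0 Ebnd Vu Vw Wp Wpt alpha beta s t.
    by have -> := triple_norm_sqr al0 be0 Vu Wp Wpt.
(* If [Emax < Emin], the values of s and t used below would exceed the bounds in terms of [Emax];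
   all three parameters are then zero. *)
have [EE|EE] := leP Emin Emax; last first.
  exists 0, 0, 0; split; first exact: VS.1.
  - by rewrite (semi_inner0 VS GI VS.1); exact: P0.
  - by rewrite mulr0 lexx invr_ge0 mulr_ge0 ?ltW.
  - exact: (coercivity_degenerate _ _ _ _ Emin0 EE CK0 al0 g0 U0 P0 T0 kornu
      (Abnd _ Vu) (dbnd _ Wp) (dbnd _ Wpt)).
have [w [Vw wp bw]] := infsup_witness CD0 infsup Wp.
have Aw : strain_prod D e0 e u w ^+ 2 <=
    Emax ^+ 2 * (grad_prod D u u * grad_prod D w w).
  apply: (le_trans (cauchy_schwarz VS SI Vu Vw)).
  have H v : V D v -> strain_prod D e0 e v v <= Emax * grad_prod D v v.
    move=> Vv; have /andP[_ Av] := Abnd _ Vv; apply: (le_trans Av).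
    exact: (ler_wpM2l (ltW Emax0) (eps_prod_le Vv)).
  rewrite expr2 mulrACA.
  exact: (ler_pM (semi_inner_ge0 SI Vu) (semi_inner_ge0 SI Vw) (H _ Vu) (H _ Vw)).
have Tp : wform D e0 e pt p ^+ 2 <= Emax ^+ 2 * (iprod D pt pt * iprod D p p).
  apply: (le_trans (cauchy_schwarz WS WI Wpt Wp)); rewrite expr2 mulrACA.
  have /andP[_ Ept] := dbnd _ Wpt; have /andP[_ Ep] := dbnd _ Wp.
  exact: (ler_pM (semi_inner_ge0 WI Wpt) (semi_inner_ge0 WI Wp) Ept Ep).
have Au : Emin * CK * grad_prod D u u <= strain_prod D e0 e u u.
  have /andP[+ _] := Abnd _ Vu; apply: le_trans.
  by rewrite -mulrA; exact: (ler_wpM2l (ltW Emin0) kornu).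
have /andP[Tpt _] := dbnd _ Wpt.
(* From [Emin <= Emax] these give [alpha * s = Emin * k1 <= Emax * k1] and [t <= Emax^-1]. *)
exists w, (Emin * k1 / alpha), (Emin / Emax ^+ 2); split; [exact: Vw|exact: wp| |].
- have -> : alpha * (Emin * k1 / alpha) = Emin * k1.
    by rewrite mulrC divfK// gt_eqF.
  split.
  + by rewrite mulr_ge0 ?(ltW Emin0) ?(ltW k10).
  + by rewrite divr_ge0 ?(ltW Emin0)// sqr_ge0.
  + by rewrite ler_pM2r.
  + rewrite expr2 invfM mulrA ler_piMl ?invr_ge0 ?(ltW Emax0)//.
    by rewrite ler_pdivrMr// mul1r.
- apply: (coercivity_bound Emin0 Emax0 CK0 CD0 al0 g0 U0 P0 T0
    (semi_inner_ge0 GI Vw) wp Au Aw bw Tpt Tp (erefl k1)).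
  + by rewrite /C1 !ge_min lexx.
  + by rewrite /C1 !ge_min lexx orbT.
  + by rewrite /C1 !ge_min lexx !orbT.
  + by rewrite /C1 !ge_min lexx !orbT.
Qed.
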